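(* Suppose that (persistent connectivity) the directed graph $(\mathcal{N},\tilde{\mathcal{E}})$ with $\tilde{\mathcal{E}}=\{(j,i)\in\mathcal{N}\times\mathcal{N} \mid \int_0^{+\infty}a_{ij}(s)\,ds=+\infty\}$ is strongly connected. Then every trajectory $x$ of the system $\dot x_i(t)=\sum_{j=1}^n a_{ij}(t)(x_j(t)-x_i(t))$, $i\in\mathcal{N}$, satisfies, for all $p\in\mathbb{N}$, $$\Delta_{\mathcal{N}}(t_{p+1})\le\left(1-\frac{\mathbf{r}(t_{p+1})^{-\lfloor n/2\rfloor}}{(8n^2)^{\lfloor n/2\rfloor}}\right)\Delta_{\mathcal{N}}(t_p),$$ where $\Delta_{\mathcal{N}}(t)=\max_{i\in\mathcal{N}}x_i(t)-\min_{j\in\mathcal{N}}x_j(t)$.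
   Context: Let $n\ge 2$ and $\mathcal{N}=\{1,\dots,n\}$. For $i,j\in\mathcal{N}$, let $a_{ij}:\mathbb{R}^+\to[0,+\infty)$ be measurable and integrable on bounded intervals of $\mathbb{R}^+=[0,+\infty)$. The system $\dot x_i(t)=\sum_{j=1}^n a_{ij}(t)(x_j(t)-x_i(t))$, $i\in\mathcal{N}$, is understood in the Carathéodory sense: a trajectory is a locally absolutely continuous $x:\mathbb{R}^+\to\mathbb{R}^n$ with $x_i(t)=x_i(0)+\int_0^t\sum_{j=1}^n a_{ij}(s)(x_j(s)-x_i(s))\,ds$ for all $t\ge 0$, $i\in\mathcal{N}$. Reciprocity ratio: for a non-empty proper subset $S\subsetneq\mathcal{N}$, let $r_S(t)=\frac{\sum_{i\in S,j\notin S}a_{ij}(t)}{\sum_{i\in S,j\notin S}a_{ji}(t)}$ if the denominator is positive, $r_S(t)=1$ if numerator and denominator are both zero, and $r_S(t)=+\infty$ if the denominator is zero and the numerator is positive. Let $r(t)=\max_{\emptyset\ne S\subsetneq\mathcal{N}}r_S(t)$ and $\mathbf{r}(t)=\sup_{s\in[0,t]}r(s)\in[1,+\infty]$. Convention: $(+\infty)^{-k}=0$ for every integer $k\ge1$. A directed graph on $\mathcal{N}$ is strongly connected if there is a directed path from $i$ to $j$ for all distinct $i,j\in\mathcal{N}$. Time sequence (well defined under persistent connectivity): $t_0=0$; for $p\in\mathbb{N}=\{0,1,2,\dots\}$, set $t_p^0=t_p$ and, for $q\in\{0,\dots,\lfloor n/2\rfloor-1\}$, let $t_p^{q+1}$ be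 the smallest $t\ge t_p^q$ such that $\min_{\emptyset\ne S\subsetneq\mathcal{N}}\Big(\sum_{i\in S}\sum_{j\in\mathcal{N}\setminus S}\int_{t_p^q}^{t}a_{ij}(s)\,ds\Big)=1$; finally $t_{p+1}=t_p^{\lfloor n/2\rfloor}$. *)

(* Defs.v *)
From mathcomp Require Import all_boot all_order all_algebra.
From mathcomp Require Import all_classical all_reals all_analysis.

Set Implicit Arguments.
Unset Strict Implicit.
Unset Printing Implicit Defensive.

Import Order.TTheory GRing.Theory Num.Theory.
Import numFieldNormedType.Exports.

Local Open Scope classical_set_scope.
Local Open Scope ring_scope.

(* [R] with the sigma-algebra of Lebesgue-measurable (not only Borel) sets,
   the domain of the completed Lebesgue measure. *)
Notation lebesgueT R :=
  (caratheodory_type (measure_extension.mu_ext (wlength (@idfun R)))).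

Definition lebesgue_itv (R : realType) (J : interval R) : set (lebesgueT R) :=
  [set` J].

Notation leb := completed_lebesgue_measure.

Section AbsoluteContinuity.
Variable R : realType.
Implicit Types f : R -> R.

Definition abs_continuous_on (a b : R) f : Prop :=
  forall eps : R, 0 < eps -> exists2 delta : R, 0 < delta &
  forall (m : nat) (u v : 'I_m -> R),
    (forall k, a <= u k /\ u k <= v k /\ v k <= b) ->
    trivIset setT (fun k => [set` `]u k, v k[]) ->
    \sum_(k < m) (v k - u k) < delta ->
    \sum_(k < m) `|f (v k) - f (u k)| < eps.

Definition locally_abs_continuous f : Prop :=
  forall T, 0 <= T -> abs_continuous_on 0 T f.

End AbsoluteContinuity.

Section Consensus.
Variables (R : realType) (n : nat).

(* Agents are indexed by 'I_n = {0, ..., n-1}; [a t i j] is a_ij(t) and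
   [x t 0 i] is x_i(t). Values at negative times are never used. *)
Implicit Types (a : R -> 'M[R]_n) (x : R -> 'rV[R]_n) (S : {set 'I_n}).

Definition admissible a : Prop := forall i j : 'I_n,
  [/\ forall t, 0 <= t -> 0 <= a t i j,
      measurable_fun (lebesgue_itv `[0, +oo[) (fun t => a t i j) &
      forall u v, 0 <= u ->
        leb.-integrable (lebesgue_itv `[u, v]) (fun t => (a t i j)%:E)].

Definition trajectory a x : Prop := forall i : 'I_n,
  locally_abs_continuous (fun t => x t 0 i) /\
  forall t, 0 <= t ->
    x t 0 i = x 0 0 i +
      \int[leb]_(s in lebesgue_itv `[0, t])
         (\sum_(j < n) a s i j * (x s 0 j - x s 0 i)).

Definition proper_nonempty S : bool :=
  (S != finset.set0) && (S \proper finset.setT).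

Definition inflow (A : 'M[R]_n) S : R :=
  \sum_(i in S) \sum_(j | j \notin S) A i j.

Definition reciprocity_ratio a S t : \bar R :=
  let num := inflow (a t) S in
  let den := inflow (a t)^T S in
  if 0 < den then (num / den)%:E
  else if num == 0 then 1%E else +oo%E.

Definition max_ratio a t : \bar R :=
  \big[maxe/-oo%E]_(S : {set 'I_n} | proper_nonempty S) reciprocity_ratio a S t.

Definition sup_ratio a t : \bar R :=
  ereal_sup [set max_ratio a s | s in `[0, t]].

(* r ^ (-k) for k >= 1: in the extended reals (+oo)^-1 = 0. *)
Definition ratio_pow a t (k : nat) : R := fine ((sup_ratio a t)^-1 ^+ k)%E.

(* [edge a j i]: there is an edge from j to i, i.e. a_ij is not integrable. *)
Definition edge a : rel 'I_n := fun j i =>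
  (\int[leb]_(s in lebesgue_itv `[0%R, +oo[) (a s i j)%:E == +oo)%E.

Definition strongly_connected (e : rel 'I_n) : Prop :=
  forall i j : 'I_n, i != j -> connect e i j.

Definition min_cut a (u t : R) : \bar R :=
  \big[mine/+oo%E]_(S : {set 'I_n} | proper_nonempty S)
    (\sum_(i in S) \sum_(j | j \notin S)
       \int[leb]_(s in lebesgue_itv `[u, t]) (a s i j)%:E)%E.

Definition least (P : set R) (t : R) : Prop := P t /\ lbound P t.

(* The default value 0 of [xget] only matters if there is no smallest t. *)
Definition next_time a (u : R) : R :=
  xget 0 (least [set t | u <= t /\ min_cut a u t = 1%E]).

Fixpoint time a (p : nat) : R :=
  if p is p'.+1 then iter n./2 (next_time a) (time a p') else 0.

(* Over the non-empty finite type 'I_n, sup and inf are max and min. *)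
Definition spread x (t : R) : R :=
  sup (range (fun i => x t 0 i)) - inf (range (fun i => x t 0 i)).

End Consensus.

(* Main.v *)
(* Fix an instant and suppose, after replacing x by M - x if necessary, that at
   least half of the agents are at or above the midpoint of the current range,
   and shift the minimum to 0. Let S be the set of agents above a level m > 0.
   While the weight entering S integrates to at most 1/2, the agents of S stay
   above m/2. When that integral reaches 1/2, reciprocity has let at least
   1/(2r) flow out of S; the ranked sum of (2r)^(rank i) x_i over the agents
   outside S, ranked by decreasing value, has then grown to m/(8r), because
   weights growing by a factor larger than r per rank make the internal
   exchanges contribute nonnegatively. Hence, for some k >= 1, at least #|S| + k
   agents are above m/(4nr)^k: several agents may be gained at once, at a price
   of one factor 4nr each. Iterating, every interval of the time sequence gains
   at least one agent until none is left, and only n./2 agents are missing. *)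
Require Import Defs.
From mathcomp Require Import all_boot all_order all_algebra fingroup perm.
From mathcomp Require Import all_classical all_reals all_analysis.
From mathcomp Require Import measurable_realfun.
From mathcomp Require Import zify ring lra.

Set Implicit Arguments.
Unset Strict Implicit.
Unset Printing Implicit Defensive.

Import Order.TTheory GRing.Theory Num.Theory.
Import numFieldNormedType.Exports.
Local Open Scope ring_scope.

(** * Integrals over intervals for the completed Lebesgue measure *)

Section Integral.
Local Open Scope classical_set_scope.
Local Open Scope ring_scope.
Context {R : realType}.
Implicit Types (f g : R -> R) (s t u v w : R).

Lemma measurable_lebesgue_itv (J : interval R) : measurable (lebesgue_itv J).
Proof. by apply: sub_caratheodory; exact: measurable_itv. Qed.
Hint Resolve measurable_lebesgue_itv : core.

Lemma leb_itv (b c : bool) s t : s <= t ->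
  leb (lebesgue_itv (Interval (BSide b s) (BSide c t))) = (t - s)%:E.
Proof.
move=> st.
have := @lebesgue_measure_itv R (Interval (BSide b s) (BSide c t)).
rewrite /= lte_fin; case: ltP => // ts.
have -> : t - s = 0 by lra.
done.
Qed.

Definition itg f s t : R := \int[leb]_(r in lebesgue_itv `[s, t]) f r.

Definition loc_integrable f : Prop := forall s t, 0 <= s ->
  leb.-integrable (lebesgue_itv `[s, t]) (EFin \o f).

Lemma itg_split f s t u : loc_integrable f -> 0 <= s -> s <= t -> t <= u ->
  itg f s u = itg f s t + itg f t u.
Proof.
move=> fi s0 st tu; have t0 := le_trans s0 st.
(* The closed intervals share the endpoint [t]. Since a point is a null set, the second one may be
   made half-open, and additivity over disjoint sets applies. *)
have -> : itg f t u = \int[leb]_(r in lebesgue_itv `]t, u]) f r.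
  rewrite /itg.
  have -> : lebesgue_itv `[t, u] =
      lebesgue_itv `[t, t] `|` lebesgue_itv `]t, u].
    by apply/seteqP; split => r; rewrite /lebesgue_itv /= !in_itv /=; lra.
  have zero : \int[leb]_(r in lebesgue_itv `[t, t]) f r = 0.
    have mf := measurable_int _ (fi t t t0).
    have t_null : leb (lebesgue_itv `[t, t]) = 0%E.
      by have := leb_itv true false (lexx t); rewrite subrr.
    by rewrite /Rintegral (null_set_integral (measurable_lebesgue_itv _) mf t_null).
  rewrite Rintegral_setU //.
  - by rewrite zero add0r.
  - apply: integrableS (fi t u t0) => //; first exact: measurableU.
    by move=> r; rewrite /lebesgue_itv /= !in_itv /=; lra.
  - by apply/disj_setPS => r []; rewrite /lebesgue_itv /= !in_itv /=; lra.
rewrite /itg -Rintegral_setU//.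
- congr (Rintegral _ _ _).
  by apply/seteqP; split => r; rewrite /lebesgue_itv /= !in_itv /=; lra.
- apply: integrableS (fi s u s0) => //; first exact: measurableU.
  by move=> r; rewrite /lebesgue_itv /= !in_itv /=; lra.
- by apply/disj_setPS => r []; rewrite /lebesgue_itv /= !in_itv /=; lra.
Qed.

Lemma itg_pt f s : loc_integrable f -> 0 <= s -> itg f s s = 0.
Proof.
by move=> fi s0; have := itg_split fi s0 (lexx s) (lexx s); lra.
Qed.

Lemma le_itg f g s t : loc_integrable f -> loc_integrable g -> 0 <= s ->
  (forall r, s <= r <= t -> f r <= g r) -> itg f s t <= itg g s t.
Proof.
move=> fi gi s0 fg; apply: le_Rintegral; [by []|exact: fi|exact: gi|].
by move=> r; rewrite /lebesgue_itv /= in_itv /=; exact: fg.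
Qed.

Lemma itg_ge0 f s t : (forall r, s <= r <= t -> 0 <= f r) -> 0 <= itg f s t.
Proof.
move=> f0; apply: Rintegral_ge0 => r.
by rewrite /lebesgue_itv /= in_itv /=; exact: f0.
Qed.

Lemma eq_itg f g s t : (forall r, s <= r <= t -> f r = g r) ->
  itg f s t = itg g s t.
Proof.
move=> fg; apply: eq_Rintegral => r; rewrite inE /lebesgue_itv /= in_itv /=.
exact: fg.
Qed.

Lemma loc_integrable0 : loc_integrable (fun=> 0).
Proof. by move=> s t s0; exact: integrable0. Qed.

Lemma loc_integrableD f g : loc_integrable f -> loc_integrable g ->
  loc_integrable (fun r => f r + g r).
Proof. by move=> fi gi s t s0; apply: (integrableD _ (fi s t s0) (gi s t s0)). Qed.

Lemma loc_integrableZ k f : loc_integrable f -> loc_integrable (fun r => k * f r).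
Proof. by move=> fi s t s0; apply: (integrableZl _ k (fi s t s0)). Qed.

Lemma loc_integrable_sum (I : Type) (r : seq I) (P : pred I) (F : I -> R -> R) :
  (forall i, P i -> loc_integrable (F i)) ->
  loc_integrable (fun x => \sum_(i <- r | P i) F i x).
Proof.
move=> Fi; elim: r => [|i r IH].
  by under eq_fun do rewrite big_nil; exact: loc_integrable0.
have -> : (fun x => \sum_(j <- i :: r | P j) F j x) =
    (if P i then fun x => F i x + \sum_(j <- r | P j) F j x
     else fun x => \sum_(j <- r | P j) F j x).
  by apply/funext => x; rewrite big_cons; case: ifP.
by case: ifP => // Pi; apply: loc_integrableD => //; exact: Fi.
Qed.

Lemma itgD f g s t : loc_integrable f -> loc_integrable g -> 0 <= s ->
  itg (fun r => f r + g r) s t = itg f s t + itg g s t.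
Proof. by move=> fi gi s0; apply: RintegralD; [by []|exact: fi|exact: gi]. Qed.

Lemma itgZ k f s t : loc_integrable f -> 0 <= s ->
  itg (fun r => k * f r) s t = k * itg f s t.
Proof. by move=> fi s0; apply: RintegralZl => //; exact: fi. Qed.

Lemma itg_sum (I : Type) (r : seq I) (P : pred I) (F : I -> R -> R) s t :
  (forall i, P i -> loc_integrable (F i)) -> 0 <= s ->
  itg (fun x => \sum_(i <- r | P i) F i x) s t =
  \sum_(i <- r | P i) itg (F i) s t.
Proof.
move=> Fi s0; elim: r => [|i r IH].
  rewrite big_nil -[RHS](mul0r (itg (fun=> 0) s t)) -itgZ//.
    by apply: eq_itg => x _; rewrite big_nil mul0r.
  exact: loc_integrable0.
rewrite big_cons -IH; case: ifP => Pi; last first.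
  by apply: eq_itg => x _; rewrite big_cons Pi.
rewrite -itgD//; [|exact: Fi|exact: loc_integrable_sum].
by apply: eq_itg => x _; rewrite big_cons Pi.
Qed.

(** Extending [f] by zero outside [[0, T]] makes it integrable on the line, so absolute continuity
    of the integral yields one [d] for all subintervals. *)
Lemma itg_small f T e : loc_integrable f -> 0 < e ->
  exists2 d : R, 0 < d & forall s t, 0 <= s -> s <= t -> t <= T ->
    t - s < d -> itg (fun r => `|f r|) s t < e.
Proof.
move=> fi e0.
have fT : leb.-integrable setT (EFin \o (f \_ (lebesgue_itv `[0, T]))).
  have := fi 0 T (lexx 0).
  by move=> /(integrable_mkcond _ (measurable_lebesgue_itv _)); rewrite restrict_EFin.
have [d [d0 H]] := integral_normr_continuous fT e0.
exists d => // s t s0 st tT tsd.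
have := H _ (measurable_lebesgue_itv `[s, t]).
have := leb_itv true false st => /= ->; rewrite lte_fin => /(_ tsd).
apply: le_lt_trans; rewrite le_eqVlt; apply/orP; left; apply/eqP.
apply: eq_Rintegral => r; rewrite inE /lebesgue_itv/= in_itv/= => rst.
rewrite patchE mem_set// /lebesgue_itv /= in_itv/=; lra.
Qed.

End Integral.

(** * Hitting times, divergent integrals and products with continuous functions *)

Section Continuity.
Local Open Scope classical_set_scope.
Local Open Scope ring_scope.
Context {R : realType}.
Implicit Types (f g y F : R -> R) (s t u v w c : R).

(** The witness is the infimum of the points where [F] is at least [c]. A value above [c] there
    would put a slightly earlier point into the set; a value below [c] would contradict that points
    of the set come arbitrarily close from the right. *)
Lemma first_hit F u v c : u <= v ->
  (forall s t, u <= s -> s <= t -> t <= v -> F s <= F t) ->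
  (forall e, 0 < e -> exists2 d, 0 < d & forall s t, u <= s -> s <= t ->
     t <= v -> t - s < d -> F t - F s < e) ->
  F u <= c -> c <= F v ->
  exists w, [/\ u <= w, w <= v, F w = c & forall t, u <= t -> F t = c -> w <= t].
Proof.
move=> uv F_ndecr F_cont Fu Fv.
pose E := [set t | [/\ u <= t, t <= v & c <= F t]].
have Ev : E v by split.
have infE : has_inf E by split; [exists v | exists u => t []].
have uw : u <= inf E by apply: lb_le_inf; [exists v | move=> t []].
have wv : inf E <= v by apply: ge_inf => //; exact: infE.2.
exists (inf E); split => //; last first.
  move=> t ut Ft; have [tv|/ltW vt] := lerP t v; last exact: le_trans vt.
  by apply: ge_inf; [exact: infE.2 | split => //; rewrite Ft].
apply/eqP; rewrite eq_le; apply/andP; split; rewrite leNgt; apply/negP => Fw.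
- have uw' : u < inf E.
    by rewrite lt_neqAle uw andbT; apply/eqP => uE; rewrite -uE in Fw; lra.
  have [|d d0 Fd] := F_cont (F (inf E) - c); first lra.
  pose s := Num.max u (inf E - d / 2).
  have us : u <= s by rewrite le_max lexx.
  have sw : s < inf E by rewrite gt_max uw' /=; lra.
  have sd : inf E - s < d.
    have : inf E - d / 2 <= s by rewrite le_max lexx orbT.
    lra.
  have Es : E s.
    split => //; first by apply: ltW; exact: lt_le_trans wv.
    by have := Fd s (inf E) us (ltW sw) wv sd; lra.
  have := ge_inf infE.2 Es; lra.
- have [|d d0 Fd] := F_cont (c - F (inf E)); first lra.
  have [t [ut tv ct] td] := inf_adherent d0 infE.
  have wt : inf E <= t by apply: ge_inf; [exact: infE.2 | split].
  by have := Fd (inf E) t uw wt tv; lra.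
Qed.

Lemma itg_first_hit f u v c : loc_integrable f -> 0 <= u -> u <= v ->
  (forall t, 0 <= t -> 0 <= f t) -> 0 <= c -> c <= itg f u v ->
  exists2 w, u <= w <= v & itg f u w = c.
Proof.
move=> fi u0 uv f0 c0 cv.
have split_uw s t : u <= s -> s <= t -> itg f u t = itg f u s + itg f s t.
  by move=> us st; exact: itg_split.
have ndecr s t : u <= s -> s <= t -> t <= v -> itg f u s <= itg f u t.
  move=> us st tv; rewrite (split_uw s t us st) lerDl.
  by apply: itg_ge0 => r /andP[sr _]; apply: f0; lra.
have cont e : 0 < e -> exists2 d, 0 < d & forall s t, u <= s -> s <= t ->
    t <= v -> t - s < d -> itg f u t - itg f u s < e.
  move=> e0; have [d d0 Hd] := itg_small v fi e0.
  exists d => // s t us st tv td; rewrite (split_uw s t us st) addrC addKr.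
  apply: le_lt_trans (Hd s t _ st tv td); last lra.
  rewrite le_eqVlt; apply/orP; left; apply/eqP; apply: eq_itg => r /andP[sr _].
  by rewrite ger0_norm// f0//; lra.
have fu : itg f u u <= c by rewrite itg_pt.
have [w [uw wv fw _]] := first_hit uv ndecr cont fu cv.
by exists w => //; rewrite uw.
Qed.

(** If all integrals from [u] stayed below [c], those over [[0, k]] would be at most
    [itg f 0 u + |c|], and monotone convergence would make the integral over the half-line finite.
    The absolute value covers the [k] below [u]. *)
Lemma itg_unbounded f u c : loc_integrable f -> 0 <= u ->
  (forall t, 0 <= t -> 0 <= f t) ->
  (\int[leb]_(s in lebesgue_itv `[0%R, +oo[) (f s)%:E = +oo)%E ->
  exists2 v, u <= v & c <= itg f u v.
Proof.
move=> fi u0 f0 foo.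
apply: contrapT => H.
have lt_c v : u <= v -> itg f u v <= c.
  by move=> uv; rewrite leNgt; apply/negP => /ltW cv; apply: H; exists v.
pose F (k : nat) := lebesgue_itv `[0%R, k%:R : R].
have mF k : measurable (F k) by exact: measurable_lebesgue_itv.
have ndF : nondecreasing_seq F.
  move=> k l kl; rewrite subsetEset => r; rewrite /F /lebesgue_itv /= !in_itv /=.
  by move=> /andP[-> rk] /=; apply: le_trans rk _; rewrite ler_nat.
have bigF : \bigcup_k F k = lebesgue_itv `[0%R, +oo[.
  apply/seteqP; split => r.
    by move=> [k _]; rewrite /F /lebesgue_itv /= !in_itv /= andbT => /andP[].
  rewrite /lebesgue_itv /= in_itv /= andbT => r0.
  exists (Num.truncn r).+1 => //; rewrite /F /lebesgue_itv /= in_itv /= r0 /=.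
  exact/ltW/truncnS_gt.
have mf k := measurable_int _ (fi 0 k%:R (lexx 0)).
have := @ge0_nondecreasing_set_cvg_integral _ _ _ F (EFin \o f) leb ndF mF mf.
rewrite bigF foo => /(_ _) cv.
have {}cv : (\int[leb]_(x in F i) (EFin \o f) x)%E @[i --> \oo] --> +oo%E.
  apply: cv => k x; rewrite /F /lebesgue_itv /= in_itv /= => /andP[x0 _].
  by rewrite lee_fin f0.
have : (+oo <= (itg f 0 u + `|c|)%:E :> \bar R)%E.
  apply: (@cvge_le _ _ _ _ _ _ _ _ cv); apply: nearW => k.
  have fin : (\int[leb]_(x in F k) (EFin \o f) x)%E \is a fin_num.
    by apply: integrable_fin_num => //; exact: fi.
  rewrite -(fineK fin) lee_fin.
  rewrite -[leLHS]/(itg f 0 k%:R).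
  have [uk|/ltW ku] := lerP u k%:R.
    rewrite (itg_split fi (lexx 0) u0 uk) lerD2l.
    by apply: le_trans (lt_c _ uk) _; exact: ler_norm.
  rewrite (itg_split fi (lexx 0) (ler0n _ k) ku) -addrA lerDl addr_ge0//.
  by apply: itg_ge0 => r /andP[kr _]; apply: f0; apply: le_trans kr.
by rewrite leye_eq.
Qed.

(** Continuity on the half-line as a modulus on each [[0, T]], because values at negative times are
    arbitrary. *)
Definition loc_uniform_continuous y : Prop := forall T e, 0 < e ->
  exists2 d, 0 < d & forall s t, 0 <= s -> s <= t -> t <= T ->
    t - s < d -> `|y t - y s| < e.

(** Clamping the time to [[0, T]] is 1-Lipschitz, so it turns [y] into a function continuous on the
    whole line without changing it on [[0, T]]. *)
Lemma clamp_continuous y T : loc_uniform_continuous y -> 0 <= T ->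
  continuous (fun r : R => y (Num.max 0 (Num.min r T))).
Proof.
move=> yc T0 r; pose clamp r : R := Num.max 0 (Num.min r T).
apply/cvgrPdist_lt => e e0; have [d d0 yd] := yc T e e0.
apply/nbhs_ballP; exists d => // s; rewrite /ball /= => rs.
have clamp0 p : 0 <= clamp p by rewrite le_max lexx.
have clampT p : clamp p <= T by rewrite ge_max T0 ge_min lexx orbT.
have clamp_dist : `|clamp r - clamp s| < d.
  apply: le_lt_trans rs; rewrite /clamp.
  have norm_rs : r - s <= `|r - s| /\ - (r - s) <= `|r - s|.
    by split; [exact: ler_norm | rewrite -normrN ler_norm].
  case: (lerP r T); case: (lerP s T); case: (lerP 0 r); case: (lerP 0 s);
    case: (lerP 0 T) => ? ? ? ? ?; rewrite ler_norml; lra.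
have [cd1 cd2] : clamp r - clamp s < d /\ clamp s - clamp r < d.
  by move: clamp_dist; rewrite ltr_norml => /andP[]; lra.
rewrite -/(clamp r) -/(clamp s).
have [c|/ltW c] := lerP (clamp s) (clamp r); first exact: yd cd1.
by rewrite distrC; exact: yd cd2.
Qed.

(** On [[s, t]] the factor [y] agrees with its clamped version, which is measurable by continuity
    and bounded on the segment by compactness. *)
Lemma loc_integrableM f y : loc_integrable f -> loc_uniform_continuous y ->
  loc_integrable (fun r => f r * y r).
Proof.
move=> fi yc s t s0; pose T := Num.max 0 t.
have T0 : 0 <= T by rewrite le_max lexx.
have tT : t <= T by rewrite le_max lexx orbT.
pose z r := y (Num.max 0 (Num.min r T)).
have zc : continuous z by exact: clamp_continuous.
have zy r : 0 <= r -> r <= t -> z r = y r.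
  by move=> r0 rt; rewrite /z min_l ?(le_trans rt)// max_r.
have mz : measurable_fun (lebesgue_itv `[s, t]) (z : lebesgueT R -> R).
  move=> mD Y mY; apply: measurableI => //.
  apply: sub_caratheodory.
  by have := continuous_measurable_fun zc measurableT mY; rewrite setTI.
have bz : [bounded z x | x in lebesgue_itv `[s, t]].
  have := @continuous_compact _ _ z `[s, t].
  move=> /(_ (continuous_subspaceT zc) (@segment_compact _ s t)) /compact_bounded.
  by move=> [M [Mr HM]]; exists M; split => // m mM r rs; apply: HM => //; exists r.
have := integrableMl (measurable_lebesgue_itv _) (fi s t s0) mz bz.
apply: (eq_integrable (measurable_lebesgue_itv _)) => r.
rewrite inE /lebesgue_itv /= in_itv /= => /andP[sr rt].
by rewrite -EFinM zy//; lra.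
Qed.

End Continuity.

(** * Lower bounds along solutions *)

Section Dynamics.
Context {R : realType} {n : nat}.
Implicit Types (a : R -> 'M[R]_n) (y : R -> 'I_n -> R) (A : 'M[R]_n)
  (v : 'I_n -> R).

Definition velocity A v (i : 'I_n) : R := \sum_j A i j * (v j - v i).

Definition total A : R := \sum_i \sum_j A i j.

Definition weights a : Prop :=
  (forall t i j, 0 <= t -> 0 <= a t i j) /\
  forall i j, loc_integrable (fun t => a t i j).

(** The consequence of [trajectory] on which the estimates rest: increments between two arbitrary
    instants, with uniform instead of absolute continuity. *)
Definition solution a y : Prop := forall i,
  loc_uniform_continuous (fun t => y t i) /\
  forall s t, 0 <= s -> s <= t ->
    y t i - y s i = itg (fun r => velocity (a r) (y r) i) s t.

Lemma loc_integrable_total a : weights a ->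
  loc_integrable (fun t => total (a t)).
Proof. by move=> [_ ai]; do 2 (apply: loc_integrable_sum => ? _); exact: ai. Qed.

Lemma total_ge0 a t : weights a -> 0 <= t -> 0 <= total (a t).
Proof. by move=> [a0 _] t0; do 2 (apply: sumr_ge0 => ? _); exact: a0. Qed.

Lemma loc_integrable_velocity a y i : weights a ->
  (forall j, loc_uniform_continuous (fun t => y t j)) ->
  loc_integrable (fun r => velocity (a r) (y r) i).
Proof.
move=> [_ ai] yc; apply: loc_integrable_sum => j _.
under eq_fun do rewrite mulrBr -mulN1r.
apply: loc_integrableD; first by apply: loc_integrableM => //; exact: yc.
by apply: loc_integrableZ; apply: loc_integrableM => //; exact: yc.
Qed.

Lemma solution_modulus a y T e : solution a y -> 0 < e ->
  exists2 d, 0 < d & forall i s t, 0 <= s -> s <= t -> t <= T ->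
    t - s < d -> `|y t i - y s i| < e.
Proof.
move=> ys e0.
have D i : {d | 0 < d & forall s t, 0 <= s -> s <= t -> t <= T ->
    t - s < d -> `|y t i - y s i| < e}.
  by apply: cid2; exact: (ys i).1.
pose d i := s2val (D i).
exists (\big[Num.min/1]_i d i).
  by apply: lt_bigmin => // i _; exact: s2valP (D i).
move=> i s t s0 st tT /bigmin_gtP[_ /(_ i isT) tsd].
by apply: (s2valP' (D i)).
Qed.

Lemma velocity_dist A v v' e i : (forall i j, 0 <= A i j) ->
  (forall i, `|v i - v' i| <= e) ->
  `|velocity A v i - velocity A v' i| <= 2 * e * \sum_j A i j.
Proof.
move=> A0 ve; rewrite /velocity -sumrB mulr_sumr.
apply: le_trans (ler_norm_sum _ _ _) _; apply: ler_sum => j _.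
rewrite -mulrBr normrM ger0_norm// mulrC ler_wpM2r//.
by have := ve i; have := ve j; rewrite !ler_norml; lra.
Qed.

(** The functional that is minimal at [t] was at least [k] at [s], so only its own growth has to be
    bounded. The bound [g] is known for velocities frozen at [y t]; passing to the actual values
    costs at most [2 * C * e] per unit of total weight. *)
Lemma functional_growth_step (T : finType) (c : T -> 'I_n -> R) (d : T -> R)
    a y (g : R -> R) (C e k s t : R) :
  weights a -> solution a y -> loc_integrable g -> 0 <= s -> s <= t ->
  (forall x i, `|c x i| <= C) -> 0 <= e ->
  (forall r i, s <= r <= t -> `|y r i - y t i| <= e) ->
  (forall x, k <= \sum_i c x i * y s i + d x) ->
  (forall x, (forall x', \sum_i c x i * y t i + d x <=
                         \sum_i c x' i * y t i + d x') ->
   forall r, s <= r <= t -> g r <= \sum_i c x i * velocity (a r) (y t) i) ->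
  forall x, k + itg g s t - 2 * C * e * itg (fun r => total (a r)) s t <=
            \sum_i c x i * y t i + d x.
Proof.
move=> aw ys gi s0 st cC e0 ye ks g_le x0.
have [x _ x_min] := @arg_minP _ _ _ x0 xpredT
  (fun x => \sum_i c x i * y t i + d x) isT.
have {x_min}x_min x' := x_min x' isT.
apply: le_trans (x_min x0).
have velo_i i := loc_integrable_velocity i aw (fun j => (ys j).1).
have sum_i : loc_integrable (fun r => \sum_i c x i * velocity (a r) (y r) i).
  by apply: loc_integrable_sum => i _; exact: loc_integrableZ.
have tot_i := loc_integrable_total aw.
have growth : \sum_i c x i * y t i - \sum_i c x i * y s i =
    itg (fun r => \sum_i c x i * velocity (a r) (y r) i) s t.
  rewrite itg_sum//; last by move=> i _; exact: loc_integrableZ.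
  rewrite -sumrB; apply: eq_bigr => i _.
  by rewrite itgZ// -(ys i).2// mulrBr.
suff : itg g s t - 2 * C * e * itg (fun r => total (a r)) s t <=
    itg (fun r => \sum_i c x i * velocity (a r) (y r) i) s t.
  by rewrite -growth; have := ks x; lra.
rewrite -mulNr -itgZ// -itgD//; last exact: loc_integrableZ.
apply: le_itg => //; first by apply: loc_integrableD => //; exact: loc_integrableZ.
move=> r rst; have r0 : 0 <= r by case/andP: rst; lra.
have := g_le x x_min r rst.
suff : \sum_i c x i * velocity (a r) (y t) i -
    \sum_i c x i * velocity (a r) (y r) i <= 2 * C * e * total (a r) by lra.
rewrite -sumrB /total mulr_sumr; apply: ler_sum => i _.
rewrite -mulrBr; apply: le_trans (ler_norm _) _; rewrite normrM.
have -> : 2 * C * e * (\sum_j a r i j) = C * (2 * e * \sum_j a r i j) by ring.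
apply: ler_pM => //; rewrite distrC; apply: velocity_dist => [i' j|i'].
  exact: aw.1.
exact: ye.
Qed.

(* The minimum of finitely many affine functionals along a solution: comparing
   two instants with the functional that is minimal at the later one gives a
   lower bound of its increments without differentiating the minimum. *)
Lemma functional_growth (T : finType) (c : T -> 'I_n -> R) (d : T -> R)
    a y (g : R -> R) (k u w : R) :
  weights a -> solution a y -> loc_integrable g -> 0 <= u -> u <= w ->
  (forall x, k <= \sum_i c x i * y u i + d x) ->
  (forall t x, u <= t <= w ->
    (forall x', \sum_i c x i * y t i + d x <= \sum_i c x' i * y t i + d x') ->
   forall r, u <= r <= w -> g r <= \sum_i c x i * velocity (a r) (y t) i) ->
  forall x, k + itg g u w <= \sum_i c x i * y w i + d x.
Proof.
move=> aw ys gi u0 uw ku g_le x0.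
pose C : R := 1 + \sum_x \sum_i `|c x i|.
have C_ge x i : `|c x i| <= C.
  rewrite /C (bigD1 x)//= (bigD1 i)//=.
  have : 0 <= \sum_(j | j != i) `|c x j| by exact: sumr_ge0.
  have : 0 <= \sum_(z | z != x) \sum_j `|c z j|.
    by apply: sumr_ge0 => z _; exact: sumr_ge0.
  lra.
have C0 : 0 < C.
  have : 0 <= \sum_x \sum_i `|c x i|.
    by apply: sumr_ge0 => z _; exact: sumr_ge0.
  by rewrite /C; lra.
pose G := itg (fun r => total (a r)) u w.
have tot_i := loc_integrable_total aw.
have G0 : 0 <= G.
  by apply: itg_ge0 => r /andP[ur _]; apply: total_ge0 => //; lra.
apply/ler_addgt0Pr => e e0.
(* The errors of all steps of the subdivision add up to [2 * C * h * G], which this choice keeps at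
   most [e], also when [G = 0]. *)
pose h := e / (2 * C * (G + 1)).
have h0 : 0 < h by rewrite divr_gt0// !mulr_gt0//; lra.
have [m m0 ym] := solution_modulus w ys h0.
(* Enough equal steps for each to be shorter than [m], so that every agent moves by less than [h]
   within one step. *)
pose N := (Num.truncn ((w - u) / m)).+1.
pose q := (w - u) / N%:R.
have N0 : (0 : R) < N%:R by rewrite ltr0n.
have q0 : 0 <= q by rewrite divr_ge0//; lra.
have qm : q < m by rewrite ltr_pdivrMr// mulrC -ltr_pdivrMr// truncnS_gt.
pose p (l : nat) := u + l%:R * q.
have pN : p N = w by rewrite /p /q mulrC divfK ?gt_eqF//; lra.
have pS l : p l.+1 = p l + q by rewrite /p -natr1; ring.
have up l : u <= p l by rewrite lerDl mulr_ge0.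
have p_mono l l' : (l <= l')%N -> p l <= p l'.
  by move=> ll; rewrite lerD2l ler_wpM2r// ler_nat.
have pw l : (l <= N)%N -> p l <= w by move=> /p_mono; rewrite pN.
have main l : (l <= N)%N -> forall x,
    k + itg g u (p l) - 2 * C * h * itg (fun r => total (a r)) u (p l) <=
    \sum_i c x i * y (p l) i + d x.
  elim: l => [_ x|l IH lN x].
    have -> : p 0%N = u by rewrite /p mul0r addr0.
    by rewrite !itg_pt// mulr0 subr0 addr0.
  have plS : p l <= p l.+1 by exact: p_mono.
  have pl0 : 0 <= p l by exact: le_trans (up l).
  rewrite (itg_split gi u0 (up l) plS) (itg_split tot_i u0 (up l) plS).
  have := functional_growth_step aw ys gi pl0 plS C_ge (ltW h0) _ (IH (ltnW lN)) _ x.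
  move=> /(_ _ _)/le_trans step; apply: le_trans (step _ _ _ _) => //; first lra.
  - move=> r i /andP[rl rS]; rewrite distrC; apply/ltW/ym => //.
    + exact: le_trans rl.
    + exact: pw.
    + by have := pS l; lra.
  - move=> x' x'_min r /andP[rl rS]; apply: (g_le _ _ _ x'_min).
      by rewrite up pw.
    by rewrite (le_trans (up l) rl) (le_trans rS (pw _ lN)).
have := main N (leqnn N) x0; rewrite pN -/G.
suff : 2 * C * h * G <= e by lra.
have -> : 2 * C * h * G = e * (G / (G + 1)).
  by rewrite /h; field; apply/andP; split; apply: lt0r_neq0; lra.
by rewrite ger_pMr// ler_pdivrMr; lra.
Qed.

End Dynamics.

(** * Lower bounds for all agents and for a group of agents *)

Section Cuts.
Context {R : realType} {n : nat}.
Implicit Types (a : R -> 'M[R]_n) (y : R -> 'I_n -> R) (A : 'M[R]_n)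
  (v : 'I_n -> R) (S C : {set 'I_n}).

Lemma inflow_ge0 A S : (forall i j, 0 <= A i j) -> 0 <= inflow A S.
Proof. by move=> A0; apply: sumr_ge0 => i _; exact: sumr_ge0. Qed.

Lemma inflow_tr A S : inflow A^T S = inflow A (~: S).
Proof.
rewrite /inflow exchange_big /=.
apply: eq_big => [j|j jS]; first by rewrite inE.
by apply: eq_big => [i|i _]; rewrite ?inE ?negbK// mxE.
Qed.

Lemma inflow_le_total A S : (forall i j, 0 <= A i j) -> inflow A S <= total A.
Proof.
move=> A0; rewrite /inflow /total [leRHS](bigID (mem S)) /=.
apply: ler_wpDr; first by apply: sumr_ge0 => i _; exact: sumr_ge0.
apply: ler_sum => i _; rewrite [leRHS](bigID (fun j => j \notin S)) /=.
by apply: ler_wpDr => //; exact: sumr_ge0.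
Qed.

Lemma loc_integrable_inflow a S : weights a ->
  loc_integrable (fun t => inflow (a t) S).
Proof. by move=> [_ ai]; do 2 (apply: loc_integrable_sum => ? _); exact: ai. Qed.

Lemma sum_delta (x : 'I_n) v : \sum_i (i == x)%:R * v i = v x.
Proof.
rewrite (bigD1 x)//= eqxx mul1r big1 ?addr0// => i /negbTE ->.
by rewrite mul0r.
Qed.

(** Velocities are linear in the differences of values. This allows shifting the minimum to 0 and,
    with [k = -1], exchanging upper and lower bounds. *)
Lemma solution_affine a y (k c : R) : weights a -> solution a y ->
  solution a (fun t i => c + k * y t i).
Proof.
move=> aw ys i; split=> [T e e0|s t s0 st].
  have k0 : 0 < `|k| + 1 by have := normr_ge0 k; lra.
  have [d d0 yd] := (ys i).1 T (e / (`|k| + 1)) (divr_gt0 e0 k0).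
  exists d => // s t s0 st tT td.
  have -> : c + k * y t i - (c + k * y s i) = k * (y t i - y s i) by ring.
  rewrite normrM; have := yd s t s0 st tT td; rewrite ltr_pdivlMr//.
  have := normr_ge0 (y t i - y s i); nra.
have -> : c + k * y t i - (c + k * y s i) = k * (y t i - y s i) by ring.
rewrite (ys i).2// -itgZ//; last first.
  by apply: loc_integrable_velocity => // j; exact: (ys j).1.
apply: eq_itg => r _; rewrite /velocity mulr_sumr; apply: eq_bigr => j _; ring.
Qed.

(** The functionals are the coordinates: an agent holding the minimum has nonnegative velocity, so
    the growth rate is at least 0. *)
Lemma solution_lower_bound a y (m u w : R) : weights a -> solution a y ->
  0 <= u -> u <= w -> (forall i, m <= y u i) -> forall i, m <= y w i.
Proof.
move=> aw ys u0 uw mu x.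
have := @functional_growth R n 'I_n (fun x i => (i == x)%:R) (fun=> 0)
  a y (fun=> 0) m u w aw ys loc_integrable0 u0 uw _ _ x.
have -> : itg (fun=> 0) u w = 0.
  rewrite -[RHS](mul0r (itg (fun=> 0) u w)) -itgZ//; last exact: loc_integrable0.
  by apply: eq_itg => r _; rewrite mul0r.
rewrite sum_delta !addr0; apply.
- by move=> x'; rewrite sum_delta addr0.
- move=> t z /andP[ut tw] z_min r /andP[ur rw].
  rewrite sum_delta; apply: sumr_ge0 => j _.
  rewrite mulr_ge0 ?subr_ge0//; first by apply: aw.1; lra.
  by have := z_min j; rewrite !sum_delta !addr0.
Qed.

Lemma solution_upper_bound a y (m u w : R) : weights a -> solution a y ->
  0 <= u -> u <= w -> (forall i, y u i <= m) -> forall i, y w i <= m.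
Proof.
move=> aw ys u0 uw um i.
have := @solution_lower_bound _ _ (- m) u w aw (solution_affine (-1) 0 aw ys) u0 uw.
move=> /(_ _ i); rewrite add0r mulN1r lerN2; apply => j.
by rewrite add0r mulN1r lerN2.
Qed.

(** As the lowest agent of [S], [x] can only be pulled up from within [S]. An agent outside has a
    nonnegative value, hence pulls [x] down by at most [v x <= m] per unit of weight. *)
Lemma velocity_lower_bound A S v (m : R) x : (forall i j, 0 <= A i j) ->
  x \in S -> (forall j, j \in S -> v x <= v j) -> (forall j, 0 <= v j) ->
  v x <= m -> - m * inflow A S <= velocity A v x.
Proof.
move=> A0 xS x_min v0 xm; have m0 : 0 <= m by exact: le_trans xm.
rewrite /velocity (bigID (mem S)) /=.
apply: ler_wpDl.
  by apply: sumr_ge0 => j jS; rewrite mulr_ge0 ?subr_ge0// x_min.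
rewrite /inflow (bigD1 x)//= mulrDr.
have : 0 <= m * \sum_(i in S | i != x) \sum_(j | j \notin S) A i j.
  by rewrite mulr_ge0// sumr_ge0// => i _; exact: sumr_ge0.
suff : - m * (\sum_(j | j \notin S) A x j) <=
    \sum_(i | i \notin S) A x i * (v i - v x) by lra.
rewrite mulr_sumr; apply: ler_sum => j _.
by rewrite mulrC ler_wpM2l//; have := v0 j; lra.
Qed.

(** The minimum over [S], capped at [m], can only be dragged down by weight entering [S], at rate at
    most [m] times the inflow. *)
Lemma group_lower_bound a y S (m u w : R) : weights a -> solution a y ->
  0 <= u -> u <= w -> (forall i, 0 <= y u i) -> 0 <= m ->
  (forall i, i \in S -> m <= y u i) ->
  forall i, i \in S -> m * (1 - itg (fun t => inflow (a t) S) u w) <= y w i.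
Proof.
move=> aw ys u0 uw y0 m0 Sm i iS.
have y_ge0 t j : u <= t -> 0 <= y t j.
  by move=> ut; exact: (solution_lower_bound aw ys u0 ut y0).
(* [None] stands for the constant functional [m], which caps the minimum over
   [S] at [m] and makes the decay bound linear in the integral. *)
pose c (o : option 'I_n) (j : 'I_n) : R :=
  if o is Some x then if x \in S then (j == x)%:R else 0 else 0.
pose d (o : option 'I_n) : R :=
  if o is Some x then if x \in S then 0 else m else m.
have cd o v : \sum_j c o j * v j + d o =
    if o is Some x then if x \in S then v x else m else m.
  case: o => [x|] /=; last by rewrite big1 ?add0r// => j _; rewrite mul0r.
  case: ifP => xS; first by rewrite sum_delta addr0.
  by rewrite big1 ?add0r// => j _; rewrite mul0r.
have inf_i := loc_integrable_inflow S aw.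
have := @functional_growth R n _ c d a y (fun t => - m * inflow (a t) S)
  m u w aw ys (loc_integrableZ _ inf_i) u0 uw _ _ (Some i).
rewrite itgZ// (cd (Some i) (y w)) iS mulrBr mulr1 mulNr; apply.
  by move=> o; rewrite (cd o (y u)); case: o => [x|] //; case: ifP => // xS; exact: Sm.
move=> t o /andP[ut tw] o_min r /andP[ur rw].
have a0 p q : 0 <= a r p q by apply: aw.1; lra.
have triv : - m * inflow (a r) S <= 0.
  by rewrite mulNr oppr_le0 mulr_ge0// inflow_ge0.
case: o o_min => [x|] o_min; last by rewrite big1// => j _; rewrite mul0r.
rewrite /c; case xS: (x \in S); last by rewrite big1// => j _; rewrite mul0r.
rewrite sum_delta; apply: velocity_lower_bound => // [j jS|j|].
- by have := o_min (Some j); rewrite !(cd _ (y t)) xS jS.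
- exact: y_ge0.
- by have := o_min None; rewrite !(cd _ (y t)) xS.
Qed.

End Cuts.

(** * Ranked sums and cuts *)

Section Ranks.
Context {R : realType} {n : nat}.
Implicit Types (A : 'M[R]_n) (v : 'I_n -> R) (S C : {set 'I_n}).

Lemma sum_indic_diff (V : nat -> R) (k m : nat) : (k <= m)%N ->
  \sum_(l < m) (V l - V l.+1) * (k <= l)%:R = V k - V m.
Proof.
elim: m => [|m IH]; first by rewrite leqn0 => /eqP ->; rewrite big_ord0 subrr.
rewrite leq_eqVlt => /predU1P[->|]; rewrite big_ord_recr /=.
  rewrite ltnn mulr0 addr0 subrr big1// => l _.
  by rewrite leqNgt ltnS (ltnW (ltn_ord l)) mulr0.
by rewrite ltnS => km; rewrite IH// km mulr1; ring.
Qed.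

(** Agents outside [C] have rank above [l] and gain with weight at least [B ^+ l.+1]; those of [C]
    outside [S] have rank at most [l] and lose with weight at most [B ^+ l]. By reciprocity the
    inflow into [C] is at most [B] times the inflow into its complement, so the gains prevail. *)
Lemma weighted_cut_ge0 A S C (s : 'I_n -> nat) (B r : R) (l : nat) :
  (forall i j, 0 <= A i j) -> 1 <= B -> r <= B ->
  (forall D, inflow A D <= r * inflow A^T D) ->
  S \subset C -> (forall i, i \notin S -> (i \in C) = (s i <= l)%N) ->
  0 <= \sum_(i | i \notin S) B ^+ s i *
         \sum_j A i j * ((j \in C)%:R - (i \in C)%:R).
Proof.
move=> A0 B1 rB recip SC Cs; have B0 : 0 <= B by lra.
have CA : inflow A C <= B * inflow A (~: C).
  rewrite -inflow_tr; apply: le_trans (recip C) _.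
  by rewrite ler_wpM2r// inflow_ge0// => i j; rewrite mxE.
rewrite (bigID (mem C)) /= addrC.
have -> : \sum_(i | (i \notin S) && (i \notin C)) B ^+ s i *
    (\sum_j A i j * ((j \in C)%:R - (i \in C)%:R)) =
    \sum_(i in ~: C) B ^+ s i * \sum_(j in C) A i j.
  apply: eq_big => [i|i /andP[_ /negbTE ->]].
    rewrite inE andbC; case: (boolP (i \in C)) => //= iC.
    by rewrite (contra (fintype.subsetP SC i) iC).
  congr (_ * _); rewrite [RHS]big_mkcond /=; apply: eq_bigr => j _.
  by case: ifP; rewrite subr0 ?mulr1 ?mulr0.
have -> : \sum_(i | (i \notin S) && (i \in C)) B ^+ s i *
    (\sum_j A i j * ((j \in C)%:R - (i \in C)%:R)) =
    - \sum_(i | (i \notin S) && (i \in C)) B ^+ s i * \sum_(j | j \notin C) A i j.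
  rewrite -sumrN; apply: eq_bigr => i /andP[_ ->].
  rewrite -mulrN -sumrN; congr (_ * _); rewrite [RHS]big_mkcond /=.
  by apply: eq_bigr => j _; case: (j \in C); rewrite /= ?subrr ?mulr0 ?sub0r ?mulrN1.
rewrite subr_ge0; apply: (@le_trans _ _ (B ^+ l * inflow A C)).
  rewrite /inflow mulr_sumr (bigID (fun i => i \notin S) (fun i => i \in C)) /=.
  apply: ler_wpDr.
    by apply: sumr_ge0 => i _; rewrite mulr_ge0 ?exprn_ge0 ?sumr_ge0.
  under eq_bigl do rewrite andbC.
  apply: ler_sum => i /andP[iC iS]; rewrite ler_wpM2r ?sumr_ge0//.
  by rewrite ler_weXn2l// -Cs.
apply: (@le_trans _ _ (B ^+ l.+1 * inflow A (~: C))).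
  by rewrite exprSr -mulrA ler_wpM2l// exprn_ge0.
rewrite /inflow mulr_sumr; apply: ler_sum => i iC.
under eq_bigl do rewrite inE negbK.
rewrite ler_wpM2r ?sumr_ge0//; rewrite ler_weXn2l// ltnNge -Cs.
  by rewrite inE in iC.
by rewrite inE in iC; exact: contra (fintype.subsetP SC i) iC.
Qed.

(* Abel summation: outside [S], [v] is a nonnegative combination of indicators
   of the level sets of the rank [s], for which weights growing by a factor of
   at least the reciprocity ratio per rank make every cut contribution
   nonnegative. *)
Lemma rank_weighted_velocity A S (s : 'I_n -> nat) (B r b : R) v :
  (forall i j, 0 <= A i j) -> 1 <= B -> r <= B ->
  (forall D, inflow A D <= r * inflow A^T D) ->
  (forall i, (s i < n)%N) ->
  (forall i, i \in S -> 2 * b <= v i) ->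
  (forall i, i \notin S -> 0 <= v i <= b) ->
  (forall i j, i \notin S -> j \notin S -> (s i <= s j)%N -> v j <= v i) ->
  0 <= b ->
  b * inflow A (~: S) <=
  \sum_(i | i \notin S) B ^+ s i * velocity A v i.
Proof.
move=> A0 B1 rB recip sn vS vnS v_anti b0; have B0 : 0 <= B by lra.
(* A maximum over the ranks from [l] on: it equals [v] at the rank of an agent outside [S], and
   remains nonincreasing across the ranks held by agents of [S]. *)
pose V (l : nat) : R := \big[Num.max/0]_(i | (i \notin S) && (l <= s i)%N) v i.
have Vs i : i \notin S -> V (s i) = v i.
  move=> iS; apply/eqP; rewrite eq_le; apply/andP; split; last first.
    by apply: le_bigmax_cond; rewrite iS leqnn.
  apply/bigmax_leP; split=> [|j /andP[jS ij]]; first by case/andP: (vnS i iS).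
  exact: v_anti.
have Vb l : V l <= b.
  by apply/bigmax_leP; split => // i /andP[iS _]; case/andP: (vnS i iS).
have Vn : V n = 0.
  by rewrite /V big_pred0// => i; rewrite leqNgt sn andbF.
have V_subn l : V l = V l - V n by rewrite Vn subr0.
have V_anti l : 0 <= V l - V l.+1.
  rewrite subr_ge0; apply/bigmax_leP; split; first exact: bigmax_ge_id.
  by move=> i /andP[iS li]; apply: le_bigmax_cond; rewrite iS ltnW.
pose C l : {set 'I_n} := [set j | (j \in S) || (s j <= l)%N].
(* Lowering all of [S] to the common value [2 * b] only decreases velocities outside [S], and makes
   [z] a combination of indicators of [S] and of the sets [C l]. *)
pose z j := if j \in S then 2 * b else v j.
have zE i j : i \notin S -> z j - z i = (2 * b - V 0%N) * (j \in S)%:R +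
    \sum_(l < n) (V l - V l.+1) * ((j \in C l)%:R - (i \in C l)%:R).
  have expand k : \sum_(l < n) (V l - V l.+1) * (k \in C l)%:R =
      if k \in S then V 0%N else v k.
    case: ifP => kS.
      rewrite (V_subn 0%N) -(@sum_indic_diff V 0 n)//.
      by apply: eq_bigr => l _; rewrite inE kS.
    rewrite -Vs ?kS// V_subn -sum_indic_diff; last exact/ltnW.
    by apply: eq_bigr => l _; rewrite inE kS.
  move=> iS; under eq_bigr do rewrite mulrBr.
  rewrite sumrB !expand /z (negbTE iS); case: (j \in S) => /=; ring.
have velo_z i : i \notin S -> velocity A z i <= velocity A v i.
  move=> iS; apply: ler_sum => j _; rewrite ler_wpM2l// /z (negbTE iS).
  by rewrite lerD2r; case: ifP => // /vS.
apply: (@le_trans _ _ (\sum_(i | i \notin S) B ^+ s i * velocity A z i)); last first.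
  by apply: ler_sum => i iS; rewrite ler_wpM2l ?exprn_ge0// velo_z.
have -> : \sum_(i | i \notin S) B ^+ s i * velocity A z i =
    (2 * b - V 0%N) * (\sum_(i | i \notin S) B ^+ s i * \sum_(j in S) A i j) +
    \sum_(l < n) (V l - V l.+1) * (\sum_(i | i \notin S) B ^+ s i *
         \sum_j A i j * ((j \in C l)%:R - (i \in C l)%:R)).
  rewrite mulr_sumr.
  under [X in _ = _ + X]eq_bigr do rewrite mulr_sumr.
  rewrite exchange_big -big_split /=; apply: eq_bigr => i iS.
  rewrite /velocity.
  under [X in _ * X = _]eq_bigr do rewrite (zE _ _ iS) mulrDr.
  rewrite big_split /= mulrDr; congr (_ + _).
    rewrite mulrCA; congr (_ * _).
    rewrite [in RHS]big_mkcond mulr_sumr; apply: eq_bigr => j _.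
    by case: ifP => _; rewrite ?mulr1 ?mulr0// mulrC.
  under eq_bigr do rewrite mulr_sumr.
  rewrite exchange_big mulr_sumr; apply: eq_bigr => l _.
  rewrite mulrCA; congr (_ * _); rewrite mulr_sumr; apply: eq_bigr => j _; ring.
(* The level sets contribute nonnegatively. What remains is the jump [2 * b - V 0 >= b] between [S]
   and the others, with weights at least 1. *)
apply: ler_wpDr.
  apply: sumr_ge0 => l _; rewrite mulr_ge0//.
  apply: (weighted_cut_ge0 (l := l) A0 B1 rB recip).
    by apply/fintype.subsetP => i iS; rewrite inE iS.
  by move=> i /negbTE iS; rewrite inE iS.
apply: ler_pM => //; first exact: inflow_ge0.
  by have := Vb 0%N; lra.
rewrite /inflow; under eq_bigl do rewrite inE.
apply: ler_sum => i iS.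
under eq_bigl do rewrite inE negbK.
by rewrite ler_peMl ?sumr_ge0// exprn_ege1.
Qed.

(** Rearrangement: if a larger rank carried a larger value, exchanging the two ranks would lower the
    weighted sum. *)
Lemma minimal_rank_antitone (s : {perm 'I_n}) (B : R) v : 1 < B ->
  (forall s' : {perm 'I_n},
     \sum_i B ^+ s i * v i <= \sum_i B ^+ s' i * v i) ->
  forall i j, (s i <= s j)%N -> v j <= v i.
Proof.
move=> B1 s_min i j; rewrite leq_eqVlt => /predU1P[/val_inj/perm_inj ->//|ij].
have nij : j != i by apply: contraTneq ij => ->; rewrite ltnn.
have := s_min (tperm i j * s)%g.
rewrite (bigD1 i)//= (bigD1 j)//= [leRHS](bigD1 i)//= [in leRHS](bigD1 j)//=.
rewrite !permM tpermL tpermR.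
have -> : \sum_(k | (k != i) && (k != j)) B ^+ (tperm i j * s)%g k * v k =
    \sum_(k | (k != i) && (k != j)) B ^+ s k * v k.
  by apply: eq_bigr => k /andP[ki kj]; rewrite permM tpermD// eq_sym.
have : B ^+ s i < B ^+ s j by rewrite ltr_eXn2l.
nra.
Qed.

Lemma card_low_rank (s : {perm 'I_n}) (i : 'I_n) :
  #|[set j | (s j <= s i)%N]| = (s i).+1.
Proof.
have -> : [set j | (s j <= s i)%N] = s @^-1: [set k : 'I_n | (k <= s i)%N].
  by apply/setP => j; rewrite !inE.
rewrite card_preimset; last exact: perm_inj.
transitivity (\sum_(k < n | (k < (s i).+1)%N) 1)%N.
  by rewrite -sum1_card; apply: eq_bigl => k; rewrite inE.
by rewrite (big_ord_narrow (ltn_ord (s i))) sum1_card card_ord.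
Qed.

End Ranks.

(** * Growth of level sets *)

Section Gain.
Context {R : realType} {n : nat}.
Implicit Types (a : R -> 'M[R]_n) (y : R -> 'I_n -> R) (S C : {set 'I_n}).

Definition level y (t m : R) : {set 'I_n} := [set i | m <= y t i].

(** Multiplied out, the bound on the ratio needs no case for a zero denominator; for the empty and
    the full set both sides are 0. *)
Definition reciprocal a (r u w : R) : Prop := forall t, u <= t <= w ->
  forall C : {set 'I_n}, inflow (a t) C <= r * inflow (a t)^T C.

(** Counting agents of [S] with value 0 does not change the sum, so the ranking is antitone for
    these modified values. As [v i] is positive, the [s i + 1] agents of rank at most [s i] lie
    outside [S] with values at least [v i], and they add to [S]. *)
Lemma minimal_rank_level (s : {perm 'I_n}) (B m : R) (v : 'I_n -> R) S
    (U : {set 'I_n}) i : 1 < B ->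
  (forall s' : {perm 'I_n}, \sum_(j | j \notin S) B ^+ s j * v j <=
                            \sum_(j | j \notin S) B ^+ s' j * v j) ->
  i \notin S -> 0 < v i -> m <= v i -> S \subset U ->
  (forall j, m <= v j -> j \in U) ->
  (#|S| + (s i).+1 <= #|U|)%N.
Proof.
move=> B1 s_min iS vi mv SU mU.
pose u j := if j \in S then 0 else v j.
have uE (s' : {perm 'I_n}) : \sum_(j | j \notin S) B ^+ s' j * v j =
    \sum_j B ^+ s' j * u j.
  rewrite big_mkcond; apply: eq_bigr => j _.
  by rewrite /u; case: (j \in S); rewrite ?mulr0.
have u_anti : forall j k, (s j <= s k)%N -> u k <= u j.
  by apply: (minimal_rank_antitone B1) => s'; rewrite -!uE.
pose L := [set j | (s j <= s i)%N].
have inL j : j \in L -> (j \notin S) && (v i <= v j).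
  rewrite inE => /u_anti; rewrite /u (negbTE iS).
  by case: ifP => //= _; rewrite leNgt vi.
have SL : [disjoint S & L].
  rewrite disjoint_subset; apply/fintype.subsetP => j jS; rewrite inE.
  by apply/negP => /inL; rewrite jS.
have <- : #|S :|: L| = (#|S| + (s i).+1)%N.
  rewrite -(card_low_rank s i) cardsU.
  have /eqP -> : S :&: L == finset.set0 by rewrite setI_eq0.
  by rewrite cards0 subn0.
apply: subset_leq_card; rewrite finset.subUset SU /=.
by apply/fintype.subsetP => j /inL /andP[_ vij]; apply: mU; exact: le_trans vij.
Qed.

Lemma level_gain a y (r m u w : R) S : (0 < n)%N -> weights a -> solution a y ->
  0 <= u -> u <= w -> 1 <= r -> reciprocal a r u w ->
  (forall i, 0 <= y u i) -> 0 < m -> (forall i, i \in S -> m <= y u i) ->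
  (n <= 2 * #|S|)%N ->
  itg (fun t => inflow (a t) S) u w = 1 / 2 ->
  exists t k, [/\ u <= t <= w, (0 < k)%N &
    (#|S| + k <= #|level y t ((4 * n%:R * r)^-1 ^+ k * m)|)%N].
Proof.
move=> n0 aw ys u0 uw r1 recip y0 m0 Sm nS inflow_half.
have inf_i := loc_integrable_inflow S aw.
have a0 t i j : u <= t -> 0 <= a t i j by move=> ut; apply: aw.1; lra.
have y_ge0 t j : u <= t -> 0 <= y t j.
  by move=> ut; exact: (solution_lower_bound aw ys u0 ut y0).
have n1 : (1 : R) <= n%:R by rewrite ler1n.
set e : R := (4 * n%:R * r)^-1.
have nr1 : 4 <= 4 * n%:R * r by nra.
have e0 : 0 < e by rewrite invr_gt0; lra.
have e4 : e <= 1 / 4 by rewrite mul1r lef_pV2 ?posrE; lra.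
have S_half t i : u <= t -> t <= w -> i \in S -> m / 2 <= y t i.
  move=> ut tw iS; have := group_lower_bound aw ys u0 ut y0 (ltW m0) Sm iS.
  apply: le_trans; rewrite ler_wpM2l//; first exact: ltW.
  have := itg_split inf_i u0 ut tw; rewrite inflow_half.
  have : 0 <= itg (fun t => inflow (a t) S) t w.
    apply: itg_ge0 => x /andP[tx _]; apply: inflow_ge0 => p q.
    by apply: a0; exact: le_trans tx.
  lra.
have ek_le k : (0 < k)%N -> e ^+ k * m <= m / 4.
  case: k => // k _; rewrite exprS.
  have ek1 : e ^+ k <= 1 by rewrite exprn_ile1//; lra.
  rewrite [m / 4]mulrC ler_wpM2r// ?(ltW m0)//.
  by apply: (@le_trans _ _ e); [rewrite ler_piMr// ltW | lra].
have S_level t k : u <= t -> t <= w -> (0 < k)%N -> S \subset level y t (e ^+ k * m).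
  move=> ut tw k0; apply/fintype.subsetP => i iS; rewrite inE.
  by have := S_half t i ut tw iS; have := ek_le k k0; lra.
(* Either an agent outside [S] exceeds [m / 4] at some instant, which is a gain with [k = 1], or all
   of them stay below [m / 4] while [S] stays above [m / 2]. This gap is what
   [rank_weighted_velocity] requires, with [b = m / 4]. *)
have [[t [i [ut tw iS yi]]]|small] :=
    pselect (exists t i, [/\ u <= t, t <= w, i \notin S & m / 4 < y t i]).
  exists t, 1%N; split => //; first by rewrite ut.
  have -> : (#|S| + 1 = #|i |: S|)%N by rewrite cardsU1 iS addnC.
  apply: subset_leq_card; rewrite finset.subUset S_level// andbT finset.sub1set inE.
  by have := ek_le 1%N isT; lra.
have {}small t i : u <= t -> t <= w -> i \notin S -> y t i <= m / 4.
  move=> ut tw iS; rewrite leNgt; apply/negP => yi.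
  by apply: small; exists t, i.
(* The factor 2 gives [B > 1] even for [r = 1], as the rearrangement argument needs strictly
   increasing weights. *)
pose B := 2 * r.
have B1 : 1 < B by rewrite /B; lra.
pose c (s : {perm 'I_n}) (i : 'I_n) : R := if i \in S then 0 else B ^+ s i.
have cE (s : {perm 'I_n}) v : \sum_i c s i * v i = \sum_(i | i \notin S) B ^+ s i * v i.
  rewrite [RHS]big_mkcond; apply: eq_bigr => i _.
  by rewrite /c; case: (i \in S); rewrite ?mul0r.
have growth := @functional_growth R n _ c (fun=> 0) a y
  (fun t => m / 4 / r * inflow (a t) S) 0 u w aw ys (loc_integrableZ _ inf_i) u0 uw.
have {}growth (s : {perm 'I_n}) : m / (8 * r) <= \sum_(i | i \notin S) B ^+ s i * y w i.
  have -> : m / (8 * r) = 0 + itg (fun t => m / 4 / r * inflow (a t) S) u w.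
    by rewrite itgZ// inflow_half; field; lra.
  rewrite -(cE s (y w)) -[leRHS]addr0; apply: growth.
    move=> s'; rewrite (cE s' (y u)) addr0; apply: sumr_ge0 => i _.
    by rewrite mulr_ge0// exprn_ge0//; lra.
  move=> t s' /andP[ut tw] s'_min x /andP[ux xw].
  rewrite (cE s' (fun i => velocity (a x) (y t) i)).
  apply: (@le_trans _ _ (m / 4 * inflow (a x) (~: S))).
    rewrite -mulrA ler_wpM2l//; first by lra.
    rewrite ler_pdivrMl; last by lra.
    by rewrite -inflow_tr; apply: recip; rewrite ux.
  apply: (@rank_weighted_velocity _ _ _ _ _ _ r).
  - by move=> i j; exact: a0.
  - lra.
  - by rewrite /B; lra.
  - by apply: recip; rewrite ux.
  - by move=> i; exact: ltn_ord.
  - by move=> i iS; have := S_half t i ut tw iS; lra.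
  - by move=> i iS; rewrite y_ge0//= small.
  - move=> i j iS jS ij.
    pose v k := if k \in S then 0 else y t k.
    have vE s'' : \sum_k B ^+ (s'' : {perm 'I_n}) k * v k = \sum_k c s'' k * y t k.
      apply: eq_bigr => k _; rewrite /v /c.
      by case: (k \in S); rewrite ?mulr0 ?mul0r.
    have := @minimal_rank_antitone _ _ s' B v B1 _ i j ij.
    rewrite /v (negbTE iS) (negbTE jS); apply => s''.
    by have := s'_min s''; rewrite !addr0 -/(v _) !vE.
  - lra.
have [s _ s_min] := @arg_minP _ _ _ (1%g : {perm 'I_n}) xpredT
  (fun s : {perm 'I_n} => \sum_(i | i \notin S) B ^+ s i * y w i) isT.
(* Averaging: at most [n / 2] agents lie outside [S], and their weighted values sum to at least
   [m / (8 * r)]. *)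
have [i iS yi] : exists2 i, i \notin S & m / (4 * n%:R * r) <= B ^+ s i * y w i.
  apply: contrapT => no.
  have lt_i i : i \notin S -> B ^+ s i * y w i <= m / (4 * n%:R * r).
    by move=> iS; rewrite leNgt; apply/negP => /ltW ?; apply: no; exists i.
  have [S0|[i0 i0S]] : (forall i, i \in S) \/ exists i, i \notin S.
    have [[i iS]|no'] := pselect (exists i, i \notin S); first by right; exists i.
    by left=> i; apply/negPn/negP => iS; apply: no'; exists i.
    have := growth s; rewrite big_pred0; last by move=> i; rewrite S0.
    have : 0 < m / (8 * r) by rewrite divr_gt0//; lra.
    lra.
  have : \sum_(i | i \notin S) B ^+ s i * y w i <
      \sum_(i | i \notin S) m / (4 * n%:R * r).
    apply: ltr_sum; first by apply/hasP; exists i0; rewrite ?mem_index_enum.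
    move=> i iS; rewrite ltNge; apply/negP => ?; apply: no; exists i => //.
  apply/negP; rewrite -leNgt; apply: le_trans (growth s).
  rewrite sumr_const.
  have cardS : (#|[pred i | i \notin S]|%:R : R) <= n%:R / 2.
    have cardC_S : (#|S| + #|[pred i | i \notin S]| = n)%N.
      by have := cardC (mem S); rewrite card_ord.
    rewrite ler_pdivlMr// -natrM ler_nat muln2 -addnn -[leqRHS]cardC_S leq_add2r.
    by move: nS; rewrite mul2n -addnn -[leqLHS]cardC_S leq_add2l.
  rewrite -[leLHS]mulr_natr.
  apply: (@le_trans _ _ (m / (4 * n%:R * r) * (n%:R / 2))).
    by rewrite ler_wpM2l// divr_ge0//; lra.
  rewrite le_eqVlt; apply/orP; left; apply/eqP; field.
  by apply/andP; split; apply: lt0r_neq0; lra.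
have Bs0 : 0 < B ^+ s i by rewrite exprn_gt0; lra.
(* Since [B * e = 1 / (2 * n) <= 1], dividing by [B ^+ s i] costs at most one factor [e] per rank.
   The exponent then matches the [s i + 1] agents gained. *)
have yw : e ^+ (s i).+1 * m <= y w i.
  rewrite -(ler_pM2l Bs0); apply: le_trans yi.
  rewrite exprS [m / _]mulrC -/e.
  have : (B * e) ^+ s i <= 1.
    apply: exprn_ile1; first by rewrite mulr_ge0//; lra.
    by rewrite /e ler_pdivrMr /B; nra.
  rewrite exprMn; have : 0 < e * m by exact: mulr_gt0.
  move: (B ^+ s i) (e ^+ s i) => p q em pq.
  have -> : p * (e * q * m) = (p * q) * (e * m) by ring.
  by rewrite ler_piMl// ltW.
have em0 : 0 < e ^+ (s i).+1 * m by rewrite mulr_gt0// exprn_gt0.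
exists w, (s i).+1; split => //; first by rewrite uw lexx.
apply: (minimal_rank_level B1 _ iS _ yw) => //.
- by move=> s'; exact: s_min.
- exact: lt_le_trans yw.
- exact: S_level.
- by move=> j; rewrite inE.
Qed.

End Gain.

(** * Iteration of the gain up to the whole set of agents *)

Section Contraction.
Context {R : realType} {n : nat}.
Implicit Types (a : R -> 'M[R]_n) (y : R -> 'I_n -> R) (S C : {set 'I_n}).

Lemma reciprocalS a (r u w u' w' : R) : u <= u' -> w' <= w ->
  reciprocal a r u w -> reciprocal a r u' w'.
Proof.
move=> uu ww rec t /andP[ut tw]; apply: rec.
by rewrite (le_trans uu ut) (le_trans tw ww).
Qed.

(** A gain occurs at an instant before [v] and must be carried to [v]. While the remaining inflow
    into the current set is at least 1/2, [level_gain] applies again; once it is smaller, the set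
    keeps half its level, whence a single final factor 1/2. The induction is on the number of
    missing agents. *)
Lemma level_persist a y (r v : R) (d : nat) : (0 < n)%N -> weights a ->
  solution a y -> 1 <= r ->
  forall (u m : R) S, (n - #|S| < d)%N -> 0 <= u -> u <= v ->
  reciprocal a r u v -> (forall i, 0 <= y u i) -> 0 < m ->
  (forall i, i \in S -> m <= y u i) -> (n <= 2 * #|S|)%N ->
  exists2 k, (#|S| + k <= #|level y v ((4 * n%:R * r)^-1 ^+ k * m / 2)|)%N &
    1 / 2 <= itg (fun t => inflow (a t) S) u v -> (0 < k)%N.
Proof.
move=> n0 aw ys r1; elim: d => [//|d IH] u m S nSd u0 uv rec y0 m0 Sm nS.
have inf_i := loc_integrable_inflow S aw.
have inf0 t : 0 <= t -> 0 <= inflow (a t) S.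
  by move=> t0; apply: inflow_ge0 => i j; exact: aw.1.
have [half|small] := lerP (1 / 2) (itg (fun t => inflow (a t) S) u v); last first.
  exists 0%N => //; rewrite addn0 expr0 mul1r.
  apply: subset_leq_card; apply/fintype.subsetP => i iS; rewrite inE.
  have := group_lower_bound aw ys u0 uv y0 (ltW m0) Sm iS.
  by apply: le_trans; rewrite ler_wpM2l ?(ltW m0)//; lra.
have [|w /andP[uw wv] inf_w] := itg_first_hit inf_i u0 uv inf0 _ half; first lra.
have [t [k [/andP[ut tw] k0 lev]]] := level_gain n0 aw ys u0 uw r1
  (reciprocalS (lexx u) wv rec) y0 m0 Sm nS inf_w.
set e := (4 * n%:R * r)^-1 in lev *.
have e0 : 0 < e.
  by rewrite invr_gt0 mulr_gt0 ?mulr_gt0 ?ltr0n//; lra.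
have SL := leq_trans (leq_addr k #|S|) lev.
have := IH t (e ^+ k * m) (level y t (e ^+ k * m)).
case.
- have : (#|S| < #|level y t (e ^+ k * m)|)%N.
    by apply: leq_trans lev; rewrite -addn1 leq_add2l.
  have : (#|level y t (e ^+ k * m)| <= n)%N by rewrite -[leqRHS]card_ord max_card.
  move: nSd; lia.
- exact: le_trans ut.
- exact: le_trans wv.
- exact: reciprocalS rec.
- exact: (solution_lower_bound aw ys u0 ut y0).
- by rewrite mulr_gt0// exprn_gt0.
- by move=> i; rewrite inE.
- by apply: leq_trans nS _; rewrite leq_mul2l.
move=> k' lev' _; exists (k + k')%N => [|_]; last by rewrite addn_gt0 k0.
have -> : e ^+ (k + k') * m / 2 = e ^+ k' * (e ^+ k * m) / 2 by rewrite exprD; ring.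
by rewrite addnA; apply: leq_trans lev'; rewrite leq_add2r.
Qed.

Definition well_cut a (u v : R) : Prop := forall S, proper_nonempty S ->
  1 <= itg (fun t => inflow (a t) S) u v.

(** The loss of 1/2 in [level_persist] is absorbed by replacing [4 * n * r] with [8 * n * r], since
    at least one factor is paid whenever the set is not full. The exponent [k] counts the agents
    gained over [M], and a full level set stays full. *)
Lemma level_step a y (r u v m : R) (M k : nat) : (0 < n)%N -> weights a ->
  solution a y -> 1 <= r -> 0 <= u -> u <= v ->
  reciprocal a r u v -> well_cut a u v -> (forall i, 0 <= y u i) -> 0 < m ->
  (n <= 2 * M)%N ->
  (M + k <= #|level y u ((8 * n%:R * r)^-1 ^+ k * m)|)%N ->
  exists k', [/\ (k <= k')%N,
    (M + k' <= #|level y v ((8 * n%:R * r)^-1 ^+ k' * m)|)%N &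
    #|level y v ((8 * n%:R * r)^-1 ^+ k' * m)| = n \/
    (k < k')%N /\ #|level y u ((8 * n%:R * r)^-1 ^+ k * m)| <> n].
Proof.
move=> n0 aw ys r1 u0 uv rec cut y0 m0 nM.
have n1 : (1 : R) <= n%:R by rewrite ler1n.
have nr0 : 0 < 4 * n%:R * r by rewrite mulr_gt0 ?mulr_gt0//; lra.
have eE : (8 * n%:R * r)^-1 = (4 * n%:R * r)^-1 / 2.
  by field; apply/andP; split; apply: lt0r_neq0; lra.
set e := (8 * n%:R * r)^-1 in eE *; set e' := (4 * n%:R * r)^-1 in eE.
have e'0 : 0 < e' by rewrite invr_gt0.
have e0 : 0 < e by rewrite eE divr_gt0.
set S := level y u (e ^+ k * m) => Mk.
have em0 : 0 < e ^+ k * m by rewrite mulr_gt0// exprn_gt0.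
have Slow i : i \in S -> e ^+ k * m <= y u i by rewrite inE.
have MS : (M <= #|S|)%N := leq_trans (leq_addr k M) Mk.
have nS : (n <= 2 * #|S|)%N by apply: leq_trans nM _; rewrite leq_mul2l.
have [ST|ST] := eqVneq S finset.setT.
  have full : level y v (e ^+ k * m) = finset.setT.
    apply/setP => i; rewrite !inE.
    apply: (solution_lower_bound aw ys u0 uv) => j.
    by apply: Slow; rewrite ST inE.
  have cardv : #|level y v (e ^+ k * m)| = n by rewrite full cardsT card_ord.
  exists k; split => //; last by left.
  by rewrite cardv -[leqRHS]card_ord -cardsT -ST.
have S_proper : proper_nonempty S.
  rewrite /proper_nonempty properT ST andbT -card_gt0.
  by move: nS; case: #|S| => //; rewrite muln0 leqNgt n0.
have := @level_persist a y r v (n - #|S|).+1 n0 aw ys r1 u _ S (leqnn _) u0 uv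
  rec y0 em0 Slow nS.
rewrite -/e' => -[k' lev k'0]; exists (k + k')%N.
have {}k'0 : (0 < k')%N by apply: k'0; have := cut S S_proper; lra.
split; [exact: leq_addr | | right; split].
- rewrite addnA; apply: (@leq_trans (#|S| + k')); first by rewrite leq_add2r.
  apply: leq_trans lev _; apply: subset_leq_card; apply/fintype.subsetP => i.
  rewrite !inE; apply: le_trans.
  have -> : e' ^+ k' * (e ^+ k * m) / 2 = e ^+ k * m * (e' ^+ k' / 2) by ring.
  rewrite exprD mulrAC ler_wpM2l ?(ltW em0)// eE expr_div_n.
  rewrite ler_wpM2l ?exprn_ge0 ?(ltW e'0)// lef_pV2 ?posrE ?exprn_gt0//.
  by rewrite -[leLHS]expr1 ler_weXn2l// ler1n.
- by rewrite -[X in (X < _)%N]addn0 ltn_add2l.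
- rewrite -/S => cardS; case/eqP: ST; apply/eqP.
  by rewrite eqEcard finset.subsetT cardsT card_ord cardS /=.
Qed.

(** Each interval raises the exponent [k] unless the level set is already full. From [M = n - n./2]
    agents, [M + k <= n] forces [k <= n./2], so after [n./2] intervals the level set is full. *)
Lemma majority_lower_bound a y (r m : R) (tau : nat -> R) : (0 < n)%N ->
  weights a -> solution a y -> 1 <= r -> 0 <= tau 0%N ->
  (forall q, tau q <= tau q.+1) ->
  (forall q, well_cut a (tau q) (tau q.+1)) ->
  reciprocal a r (tau 0%N) (tau n./2) ->
  (forall i, 0 <= y (tau 0%N) i) -> 0 < m ->
  (n - n./2 <= #|level y (tau 0%N) m|)%N ->
  forall i, (8 * n%:R * r)^-1 ^+ n./2 * m <= y (tau n./2) i.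
Proof.
move=> n0 aw ys r1 tau0 tauS cut rec y0 m0 maj i.
pose M := (n - n./2)%N.
have nM : (n <= 2 * M)%N.
  by rewrite /M; have := odd_double_half n; lia.
set e := (8 * n%:R * r)^-1.
have tau_mono q q' : (q <= q')%N -> tau q <= tau q'.
  by move=> /subnK <-; elim: (q' - q)%N => // d /le_trans; apply; exact: tauS.
have tau_ge0 q : 0 <= tau q by apply: le_trans (tau_mono 0%N q _).
have chain q : (q <= n./2)%N -> exists k,
    (M + k <= #|level y (tau q) (e ^+ k * m)|)%N /\
    ((q <= k)%N \/ #|level y (tau q) (e ^+ k * m)| = n).
  elim: q => [_|q IH qn].
    by exists 0%N; rewrite addn0 expr0 mul1r; split => //; left.
  have [k [Mk qk]] := IH (ltnW qn).
  have [|j|k' [kk' Mk' full]] := @level_step a y r (tau q) (tau q.+1) m M k n0 aw ys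
    r1 (tau_ge0 q) (tauS q) _ (cut q) _ m0 nM Mk.
  - by apply: reciprocalS rec; apply: tau_mono.
  - exact: (solution_lower_bound aw ys tau0 (tau_mono 0%N q _)).
  exists k'; split => //; case: full => [|[kk nfull]]; first by right.
  by case: qk => // qk; left; exact: leq_ltn_trans kk.
have [k [Mk qk]] := chain _ (leqnn _).
have card_le : (#|level y (tau n./2) (e ^+ k * m)| <= n)%N.
  by rewrite -[leqRHS]card_ord max_card.
have kn : (k <= n./2)%N by have := leq_trans Mk card_le; rewrite /M; lia.
have full : level y (tau n./2) (e ^+ k * m) = finset.setT.
  apply/eqP; rewrite eqEcard finset.subsetT cardsT card_ord /=.
  by case: qk => [nk|->//]; apply: leq_trans Mk; rewrite /M; lia.
have : i \in level y (tau n./2) (e ^+ k * m) by rewrite full inE.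
rewrite inE; apply: le_trans.
have n1 : (1 : R) <= n%:R by rewrite ler1n.
have e0 : 0 <= e by rewrite invr_ge0 mulr_ge0 ?mulr_ge0//; lra.
have e1 : e <= 1 by rewrite invf_le1 ?mulr_gt0//; nra.
by rewrite ler_wpM2r ?(ltW m0)// ler_wiXn2l.
Qed.

End Contraction.

(** * The time sequence and the reciprocity ratio *)

Section Reduction.
Context {R : realType} {n : nat}.
Implicit Types (a : R -> 'M[R]_n) (x : R -> 'rV[R]_n) (S : {set 'I_n}).

Lemma admissible_weights a : admissible a -> weights a.
Proof.
move=> aa; split=> [t i j t0|i j s t s0]; first by have [+ _ _] := aa i j; apply.
by have [_ _ +] := aa i j; apply.
Qed.

Lemma trajectory_solution a x : admissible a -> trajectory a x ->
  solution a (fun t i => x t 0 i).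
Proof.
move=> /admissible_weights aw xt.
have xc i : loc_uniform_continuous (fun t => x t 0 i).
  move=> T e e0; have [T0|T0] := lerP 0 T; last first.
    by exists 1 => // s t s0 st tT; lra.
  have [d d0 xd] := (xt i).1 T T0 e e0; exists d => // s t s0 st tT td.
  (* Absolute continuity for a family of one interval is uniform continuity. *)
  have := xd 1%N (fun=> s) (fun=> t); rewrite !big_ord1; apply => //.
  by move=> k l _ _ _; rewrite !ord1.
move=> i; split=> [|s t s0 st]; first exact: xc.
have t0 := le_trans s0 st.
rewrite ((xt i).2 t t0) ((xt i).2 s s0).
have := itg_split (loc_integrable_velocity i aw xc) (lexx 0) s0 st.
by rewrite /itg /velocity => ->; ring.
Qed.

Lemma connect_crossing (T : finType) (e : rel T) (P : pred T) u v :
  connect e u v -> ~~ P u -> P v -> exists i j, [/\ e i j, ~~ P i & P j].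
Proof.
move=> /connectP[p]; elim: p u => [u _ -> /negP//|w p IH u /= /andP[uw pw] vE nPu Pv].
by have [Pw|nPw] := boolP (P w); [exists u, w | exact: IH vE nPw Pv].
Qed.

Lemma proper_nonemptyP S :
  reflect ((exists i, i \in S) /\ exists j, j \notin S) (proper_nonempty S).
Proof.
apply: (iffP andP) => [[/set0Pn Si]|[Si [j jS]]].
  rewrite properT => ST; split => //; apply/existsP; apply: contraR ST.
  rewrite negb_exists => /forallP all_in; apply/eqP/setP => j.
  by have := all_in j; rewrite negbK inE => ->.
split; first exact/set0Pn.
by rewrite properT; apply: contra jS => /eqP ->; rewrite inE.
Qed.

Lemma min_cutE a u t : weights a -> 0 <= u ->
  min_cut a u t = \big[mine/+oo%E]_(S : {set 'I_n} | proper_nonempty S)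
    (itg (fun s => inflow (a s) S) u t)%:E.
Proof.
move=> [_ ai] u0; apply: eq_bigr => S _.
rewrite /inflow itg_sum//; last first.
  by move=> i _; apply: loc_integrable_sum => j _; exact: ai.
rewrite -sumEFin; apply: eq_bigr => i _.
rewrite itg_sum// -sumEFin; apply: eq_bigr => j _.
rewrite /itg /Rintegral fineK//; apply: integrable_fin_num; last exact: ai.
exact: measurable_lebesgue_itv.
Qed.

(** A path from outside [S] into [S] crosses its boundary along an edge, and the divergent weight of
    that edge alone exceeds any bound. *)
Lemma cut_unbounded a u S : admissible a -> strongly_connected (edge a) ->
  0 <= u -> proper_nonempty S ->
  exists2 v, u <= v & 1 <= itg (fun s => inflow (a s) S) u v.
Proof.
move=> /admissible_weights aw conn u0 /proper_nonemptyP[[i0 i0S] [j0 j0S]].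
have ij0 : j0 != i0 by apply: contraNneq j0S => ->.
have [j [i [ji jS iS]]] :=
  connect_crossing (P := fun i => i \in S) (conn _ _ ij0) j0S i0S.
have [v uv v1] := @itg_unbounded R (fun t => a t i j) u 1 (aw.2 i j) u0
  (fun t => aw.1 t i j) (eqP ji).
exists v => //; apply: le_trans v1 _; apply: le_itg => //; first exact: aw.2.
  exact: loc_integrable_inflow.
move=> r /andP[ur _]; have a0 p q : 0 <= a r p q by apply: aw.1; lra.
rewrite /inflow (bigD1 i)//= (bigD1 j)//= -addrA lerDl addr_ge0//.
  exact: sumr_ge0.
by apply: sumr_ge0 => p _; exact: sumr_ge0.
Qed.

(** The minimal cut, as a function of [t], is 0 at [u], continuous and eventually at least 1. Hence
    a first time with value 1 exists and [xget] does not return its default. *)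
Lemma next_time_spec a u : (1 < n)%N -> admissible a ->
  strongly_connected (edge a) -> 0 <= u ->
  u <= next_time a u /\ well_cut a u (next_time a u).
Proof.
move=> n1 aa conn u0; have aw := admissible_weights aa.
pose cut S t := itg (fun s => inflow (a s) S) u t.
pose S0 : {set 'I_n} := finset.set1 (Ordinal (ltnW n1)).
have S0P : proper_nonempty S0.
  apply/proper_nonemptyP; split; first by exists (Ordinal (ltnW n1)); rewrite inE.
  by exists (Ordinal n1); rewrite inE.
have inf0 S r : 0 <= r -> 0 <= inflow (a r) S.
  by move=> r0; apply: inflow_ge0 => i j; exact: aw.1.
have inf_i S := loc_integrable_inflow S aw.
have cut_split S s t : u <= s -> s <= t ->
    cut S t = cut S s + itg (fun r => inflow (a r) S) s t.
  by move=> us st; rewrite /cut (itg_split (inf_i S) u0 us st).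
have cut_mono S s t : u <= s -> s <= t -> cut S s <= cut S t.
  move=> us st; rewrite (cut_split S s t us st) lerDl; apply: itg_ge0 => r /andP[sr _].
  by apply: inf0; lra.
pose F t := cut [arg min_(S < S0 | proper_nonempty S) cut S t]%O t.
have F_le t S : proper_nonempty S -> F t <= cut S t.
  by move=> SP; rewrite /F; case: arg_minP => // S' _; apply.
have F_ex t : exists2 S, proper_nonempty S & F t = cut S t.
  by rewrite /F; case: arg_minP => // S' SP' _; exists S'.
have F_min t : min_cut a u t = (F t)%:E.
  rewrite min_cutE//; apply/eqP; rewrite eq_le; apply/andP; split.
    have [S SP ->] := F_ex t.
    exact: (bigmin_le_cond _ (fun S => (cut S t)%:E)).
  by apply: le_bigmin => [|S SP]; rewrite ?leey// lee_fin F_le.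
have F_mono s t : u <= s -> s <= t -> F s <= F t.
  move=> us st; have [S SP ->] := F_ex t.
  exact: le_trans (F_le s S SP) (cut_mono S s t us st).
have [V uV V1] : exists2 V, u <= V & 1 <= F V.
  have ex S : {v | u <= v & proper_nonempty S -> 1 <= cut S v}.
    apply: cid2; have [SP|nSP] := boolP (proper_nonempty S).
      by have [v uv v1] := cut_unbounded aa conn u0 SP; exists v.
    by exists u.
  pose v S := s2val (ex S).
  (* The latest of the finitely many times at which the individual cuts have reached 1. *)
  exists (\big[Num.max/u]_S v S); first exact: bigmax_ge_id.
  have [S SP ->] := F_ex (\big[Num.max/u]_S v S).
  apply: le_trans (s2valP' (ex S) SP) (cut_mono S _ _ (s2valP (ex S)) _).
  exact: le_bigmax.
have F_cont e : 0 < e -> exists2 d, 0 < d & forall s t, u <= s -> s <= t ->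
    t <= V -> t - s < d -> F t - F s < e.
  move=> e0; have [d d0 Hd] := itg_small V (loc_integrable_total aw) e0.
  exists d => // s t us st tV td.
  have s0 : 0 <= s by lra.
  have [S SP ->] := F_ex s.
  (* The set minimal at [s] bounds [F] at [t] from above, so an increment of [F] is at most an
     increment of one cut, hence at most the integral of the total weight. *)
  apply: (@le_lt_trans _ _ (cut S t - cut S s)); first by rewrite lerD2r F_le.
  rewrite (cut_split S s t us st) addrC addKr.
  apply: le_lt_trans (Hd s t s0 st tV td).
  apply: le_itg => //.
    move=> p q p0; rewrite (_ : _ \o _ = abse \o (EFin \o (fun r => total (a r)))).
      by apply: integrable_abse; exact: loc_integrable_total.
    by apply/funext.
  move=> r /andP[sr _]; apply: le_trans (ler_norm _).
  by apply: inflow_le_total => i j; apply: aw.1; lra.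
have F0 : F u <= 1.
  have [S SP ->] := F_ex u; rewrite /cut itg_pt//.
have [w [uw wV Fw w_min]] :=
  first_hit uV (fun s t us st _ => F_mono s t us st) F_cont F0 V1.
have : least [set t | u <= t /\ min_cut a u t = 1%E]%classic (next_time a u).
  apply: xgetPex; exists w; split=> /=; first by rewrite F_min Fw.
  by move=> t /= [ut]; rewrite F_min => -[]; exact: w_min.
case=> /= -[uN N1] _; split => // S SP.
by move: N1; rewrite F_min => -[<-]; exact: F_le.
Qed.

End Reduction.

(** * Bounds from the reciprocity ratio *)

Section Ratio.
Context {R : realType} {n : nat}.
Implicit Types (a : R -> 'M[R]_n) (S C : {set 'I_n}).

Lemma inflow_trivial (A : 'M[R]_n) C : ~~ proper_nonempty C -> inflow A C = 0.
Proof.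
move=> nP; rewrite /inflow; apply: big1 => i iC; apply: big1 => j jC.
by case/negP: nP; apply/proper_nonemptyP; split; [exists i | exists j].
Qed.

(** Complementary sets exchange numerator and denominator, so one of their two ratios is at least
    1. *)
Lemma max_ratio_ge1 a t : (1 < n)%N -> (forall i j, 0 <= a t i j) ->
  (1 <= max_ratio a t)%E.
Proof.
move=> n1 a0.
pose S : {set 'I_n} := finset.set1 (Ordinal (ltnW n1)).
have SP : proper_nonempty S.
  apply/proper_nonemptyP; split; first by exists (Ordinal (ltnW n1)); rewrite inE.
  by exists (Ordinal n1); rewrite inE.
have CP : proper_nonempty (~: S).
  apply/proper_nonemptyP; split; first by exists (Ordinal n1); rewrite !inE.
  by exists (Ordinal (ltnW n1)); rewrite !inE negbK.
have le_max C : proper_nonempty C -> (reciprocity_ratio a C t <= max_ratio a t)%E.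
  by move=> CP'; apply: (le_bigmax_cond _ (fun C => reciprocity_ratio a C t)).
have in0 C : 0 <= inflow (a t) C by exact: inflow_ge0.
have := le_max _ SP; have := le_max _ CP.
rewrite /reciprocity_ratio !inflow_tr finset.setCK.
set p := inflow (a t) S; set q := inflow (a t) (~: S).
have p0 : 0 <= p := in0 _; have q0 : 0 <= q := in0 _.
case: (ltrgtP 0 p) p0 => [pp|//|pE] _; case: (ltrgtP 0 q) q0 => [qp|//|qE] _.
- have [pq|/ltW qp'] := lerP p q => max_p max_q.
    by apply: le_trans max_p; rewrite lee_fin ler_pdivlMr// mul1r.
  by apply: le_trans max_q; rewrite lee_fin ler_pdivlMr// mul1r.
- by move=> _; apply: le_trans; rewrite leey.
- by move=> + _; apply: le_trans; rewrite leey.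
- by [].
Qed.

(** A finite supremum excludes ratios equal to [+oo]: where the denominator vanishes so does the
    numerator, and the multiplied-out bound holds. *)
Lemma sup_ratio_fin a T : (1 < n)%N -> weights a -> 0 <= T ->
  sup_ratio a T = +oo%E \/
  exists r, [/\ sup_ratio a T = r%:E, 1 <= r & reciprocal a r 0 T].
Proof.
move=> n1 aw T0.
have le_sup t : 0 <= t -> t <= T -> (max_ratio a t <= sup_ratio a T)%E.
  move=> t0 tT; apply: ereal_sup_ubound; exists t => //.
  by rewrite /= in_itv /= t0.
have sup1 : (1 <= sup_ratio a T)%E.
  apply: le_trans (le_sup 0 (lexx 0) T0).
  by apply: (max_ratio_ge1 n1) => i j; exact: aw.1.
case E : (sup_ratio a T) sup1 => [r||] // sup1; last by left.
rewrite lee_fin in sup1; right; exists r; split => // t /andP[t0 tT] C.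
have [CP|nCP] := boolP (proper_nonempty C); last first.
  rewrite inflow_trivial// mulr_ge0//; first lra.
  by apply: inflow_ge0 => i j; rewrite mxE aw.1.
have := le_sup t t0 tT; rewrite E.
have : (reciprocity_ratio a C t <= max_ratio a t)%E.
  exact: (le_bigmax_cond _ (fun C => reciprocity_ratio a C t)).
move=> /le_trans /[apply]; rewrite /reciprocity_ratio.
have : 0 <= inflow (a t)^T C by apply: inflow_ge0 => i j; rewrite mxE aw.1.
rewrite le_eqVlt => /predU1P[<-|den0].
  by rewrite ltxx; case: eqP => [->|]; rewrite ?mulr0// leye_eq.
by rewrite den0 lee_fin ler_pdivrMr.
Qed.

End Ratio.

(** * The spread and its final estimate *)

Section Spread.
Context {R : realType} {n : nat}.
Implicit Types (x : R -> 'rV[R]_n).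

Lemma spread_le x (t : R) lo hi : (0 < n)%N ->
  (forall i, lo <= x t 0 i) -> (forall i, x t 0 i <= hi) ->
  spread x t <= hi - lo.
Proof.
move=> n0 xlo xhi; rewrite /spread.
have ne : (range (fun i => x t 0 i) !=set0)%classic.
  by exists (x t 0 (Ordinal n0)); exists (Ordinal n0).
apply: lerB; first by apply: ge_sup => // _ [i _ <-].
by apply: lb_le_inf => // _ [i _ <-].
Qed.

Lemma sup_inf_range (v : 'I_n -> R) i :
  inf (range v) <= v i <= sup (range v).
Proof.
have bound j : `|v j| <= \sum_k `|v k|.
  by rewrite (bigD1 j)//= lerDl sumr_ge0.
apply/andP; split.
  apply: ge_inf; last by exists i.
  exists (- \sum_k `|v k|) => _ [j _ <-].
  by have := bound j; rewrite ler_norml => /andP[].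
apply: ub_le_sup; last by exists i.
exists (\sum_k `|v k|) => _ [j _ <-].
by have := bound j; rewrite ler_norml => /andP[].
Qed.

End Spread.

(** The stated rate has an additional factor [n ^+ K >= 2] in the denominator, which pays for
    starting at half the spread. *)
Lemma contraction_rate {R : realType} (n K : nat) (r : R) : (1 < n)%N ->
  (0 < K)%N -> 1 <= r ->
  r^-1 ^+ K / (8 * n%:R ^+ 2) ^+ K <= (8 * n%:R * r)^-1 ^+ K / 2.
Proof.
move=> n1 K0 r1; have n2 : (2 : R) <= n%:R by rewrite ler_nat.
have -> : r^-1 ^+ K / (8 * n%:R ^+ 2) ^+ K =
    (8 * n%:R * r)^-1 ^+ K * (n%:R^-1 ^+ K).
  rewrite -exprVn -!exprMn; congr (_ ^+ K); field.
  by apply/andP; split; apply: lt0r_neq0; lra.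
apply: ler_wpM2l; first by rewrite exprn_ge0// invr_ge0 mulr_ge0 ?mulr_ge0//; lra.
rewrite exprVn lef_pV2 ?posrE ?exprn_gt0//; try lra.
by apply: (le_trans n2); rewrite -[leLHS]expr1 ler_weXn2l//; lra.
Qed.

Theorem proposition2 (R : realType) (n : nat) (hn : (2 <= n)%N)
    (a : R -> 'M[R]_n) (ha : admissible a)
    (hconn : strongly_connected (edge a))
    (x : R -> 'rV[R]_n) (hx : trajectory a x) (p : nat) :
  spread x (time a p.+1) <=
    (1 - ratio_pow a (time a p.+1) n./2 / (8 * n%:R ^+ 2) ^+ n./2)
      * spread x (time a p).
Proof.
have n0 : (0 < n)%N by exact: ltnW.
have K0 : (0 < n./2)%N by rewrite half_gt0.
have aw := admissible_weights ha.
have xs := trajectory_solution ha hx.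
have next u u0 := @next_time_spec R n a u hn ha hconn u0.
have iter_ge0 u q : 0 <= u -> 0 <= iter q (next_time a) u.
  move=> u0; elim: q => //= q IH.
  exact: le_trans (next _ IH).1.
have time_ge0 q : 0 <= time a q by elim: q => //= q; exact: iter_ge0.
pose tau q := iter q (next_time a) (time a p).
have tau_ge0 q : 0 <= tau q by exact: iter_ge0.
have tauS q : tau q <= tau q.+1 := (next _ (tau_ge0 q)).1.
have cut q : well_cut a (tau q) (tau q.+1) := (next _ (tau_ge0 q)).2.
have tau_mono q : time a p <= tau q.
  by elim: q => // q /le_trans; apply; exact: tauS.
have -> : time a p.+1 = tau n./2 by [].
set K := n./2 in K0 *; set T := tau K.
have T0 : 0 <= T := tau_ge0 K.
pose lo := inf (range (fun i => x (time a p) 0 i)).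
pose hi := sup (range (fun i => x (time a p) 0 i)).
have range_p i : lo <= x (time a p) 0 i <= hi.
  exact: sup_inf_range (fun i => x (time a p) 0 i) i.
have lo_p i : lo <= x (time a p) 0 i by case/andP: (range_p i).
have hi_p i : x (time a p) 0 i <= hi by case/andP: (range_p i).
have -> : spread x (time a p) = hi - lo by [].
have lo_T := solution_lower_bound aw xs (time_ge0 p) (tau_mono K) lo_p.
have hi_T := solution_upper_bound aw xs (time_ge0 p) (tau_mono K) hi_p.
have mono : spread x T <= hi - lo by exact: spread_le.
(* For an infinite ratio the convention makes the contraction factor 1, and the claim is that the
   spread does not increase. *)
have [r_oo|[r [rE r1 rec]]] := sup_ratio_fin hn aw T0.
  rewrite /ratio_pow r_oo invey -EFin_expe expr0n gtn_eqF//= mul0r subr0 mul1r.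
  exact: mono.
have -> : ratio_pow a T K = r^-1 ^+ K.
  by rewrite /ratio_pow rE inver gt_eqF ?(lt_le_trans ltr01)// -EFin_expe.
have := contraction_rate hn K0 r1.
move: (r^-1 ^+ K / _) => c c_le.
set e := (8 * n%:R * r)^-1 ^+ K in c_le.
have lohi : lo <= hi := le_trans (lo_p (Ordinal n0)) (hi_p (Ordinal n0)).
have [D0|D0] := eqVneq lo hi.
  by move: mono; rewrite D0 subrr mulr0.
have m0 : 0 < (hi - lo) / 2 by have : lo < hi by [rewrite lt_neqAle D0]; lra.
have rec_tau : reciprocal a r (tau 0%N) (tau K).
  by apply: reciprocalS rec => //; exact: tau_ge0.
(* It suffices to move one end of the range inwards; the other end cannot move outwards. *)
suff [bound|bound] : (forall i, lo + e * ((hi - lo) / 2) <= x T 0 i) \/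
    (forall i, x T 0 i <= hi - e * ((hi - lo) / 2)).
- by have := spread_le n0 bound hi_T; nra.
- by have := spread_le n0 lo_T bound; nra.
pose A := [set i | (hi + lo) / 2 <= x (time a p) 0 i].
(* If fewer than [n - K] agents are at or above the midpoint, at least [K + 1 >= n - K] are below
   it, and reflecting the values at [hi] turns these into the upper group. In both cases the level
   is half the spread. *)
have [maj|maj] := leqP (n - K) #|A|.
- left=> i.
  suff : e * ((hi - lo) / 2) <= - lo + 1 * x T 0 i by lra.
  apply: (majority_lower_bound n0 aw (solution_affine 1 (- lo) aw xs) r1
    (tau_ge0 0%N) tauS cut rec_tau) => // [j|].
    by have := lo_p j; rewrite /tau /=; lra.
  apply: leq_trans maj _; apply: subset_leq_card; apply/fintype.subsetP => j.
  by rewrite !inE /tau /=; lra.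
- right=> i.
  suff : e * ((hi - lo) / 2) <= hi + - 1 * x T 0 i by lra.
  apply: (majority_lower_bound n0 aw (solution_affine (-1) hi aw xs) r1
    (tau_ge0 0%N) tauS cut rec_tau) => // [j|].
    by have := hi_p j; rewrite /tau /=; lra.
  have cardA : (#|A| + #|~: A| = n)%N by rewrite cardsC card_ord.
  apply: (@leq_trans #|~: A|).
    by move: maj; rewrite /K; have := odd_double_half n; lia.
  apply: subset_leq_card; apply/fintype.subsetP => j.
  by rewrite !inE /tau /=; lra.
Qed.
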